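(* Let $\Gamma=\mathrm{SL}_3(\mathbb{Z})$. For a prime $q$ let $B_q$ be the set of complete flags $(V_1,V_2)$ in $\mathbb{F}_q^3$ (subspaces $0<V_1<V_2<\mathbb{F}_q^3$ with $\dim V_1=1$, $\dim V_2=2$), and let $\Phi_q:\mathrm{SL}_3(\mathbb{Z})\to\mathrm{Sym}(B_q)$ be the action obtained by reducing modulo $q$ and acting naturally on flags. Then for every $\epsilon>0$ there is a function $f_\epsilon$ on primes with $f_\epsilon(q)\to0$ as $q\to\infty$ such that for every prime $q$ there exists $Y\subset B_q$ with $|Y|\ge(1-f_\epsilon(q))|B_q|$, such that for every $x\in Y$ there exists $Z_x\subset B_q$ with $|Z_x|\ge(1-f_\epsilon(q))|B_q|$, such that for every $y\in Z_x$ there exists $\gamma\in\Gamma$ with $\|\gamma\|_\infty\le q^{1/2+\epsilon}$ and $\Phi_q(\gamma)x=y$.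
   Context: $\|\gamma\|_\infty$ denotes the maximum absolute value of the entries of $\gamma$. *)

(* Defs.v *)
From HB Require Import structures.
From mathcomp Require Import all_boot all_order all_algebra all_fingroup.
From mathcomp Require Import all_classical all_reals all_analysis.
Set Implicit Arguments.
Unset Strict Implicit.
Unset Printing Implicit Defensive.
Import Order.TTheory GRing.Theory Num.Theory.
Import numFieldNormedType.Exports.
Local Open Scope ring_scope.

Section VspaceFinite.
(* Gives access to the subType structure {vspace vT} -> matrices. *)
Import VectorInternalTheory.
Variables (F : finFieldType) (vT : vectType F).
HB.instance Definition _ := [Countable of {vspace vT} by <:].
HB.instance Definition _ := [Finite of {vspace vT} by <:].
End VspaceFinite.

Definition complete_flag (F : fieldType)
    (V : {vspace 'cV[F]_3} * {vspace 'cV[F]_3}) : bool :=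
  [&& \dim V.1 == 1, \dim V.2 == 2 & (V.1 <= V.2)%VS].

(* 'F_q is the field with q elements only when q is prime. *)
Definition flag (q : nat) : finType :=
  {V : {vspace 'cV['F_q]_3} * {vspace 'cV['F_q]_3} | complete_flag V}.

Definition SL3Z : Type := {g : 'M[int]_3 | \det g == 1}.

Definition redmx (q : nat) (g : 'M[int]_3) : 'M['F_q]_3 := map_mx intr g.

Definition vspace_act (F : fieldType) (A : 'M[F]_3) (V : {vspace 'cV[F]_3}) :
    {vspace 'cV[F]_3} :=
  (linfun (mulmx A : 'cV[F]_3 -> 'cV[F]_3) @: V)%VS.

Lemma vspace_act1 (F : fieldType) (V : {vspace 'cV[F]_3}) :
  vspace_act 1%:M V = V.
Proof.
rewrite /vspace_act -[RHS]lim1g; congr (_ @: _)%VS.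
by apply/lfunP => v; rewrite !lfunE /= mul1mx.
Qed.

Lemma vspace_actM (F : fieldType) (A B : 'M[F]_3) (V : {vspace 'cV[F]_3}) :
  vspace_act (A *m B) V = vspace_act A (vspace_act B V).
Proof.
rewrite /vspace_act -limg_comp; congr (_ @: _)%VS.
by apply/lfunP => v; rewrite comp_lfunE !lfunE /= mulmxA.
Qed.

Lemma redmx_unit (q : nat) (g : SL3Z) : redmx q (val g) \in unitmx.
Proof. by rewrite unitmxE det_map_mx (eqP (valP g)) rmorph1 unitr1. Qed.

Lemma dim_vspace_act (F : fieldType) (A : 'M[F]_3) (V : {vspace 'cV[F]_3}) :
  A \in unitmx -> \dim (vspace_act A V) = \dim V.
Proof.
move=> uA; apply: limg_dim_eq; apply/eqP; rewrite -subv0; apply/subvP => v.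
rewrite memv_cap memv_ker lfunE /= memv0 => /andP[_ /eqP Av0].
by rewrite -[v](mulKmx uA) Av0 mulmx0.
Qed.

Lemma flag_act_subproof (q : nat) (g : SL3Z) (x : flag q) :
  complete_flag (vspace_act (redmx q (val g)) (val x).1,
                 vspace_act (redmx q (val g)) (val x).2).
Proof.
have /and3P[d1 d2 s12] := valP x.
by rewrite /complete_flag /= !dim_vspace_act ?redmx_unit // d1 d2 limgS.
Qed.

Definition flag_act (q : nat) (g : SL3Z) (x : flag q) : flag q :=
  exist _ (vspace_act (redmx q (val g)) (val x).1,
           vspace_act (redmx q (val g)) (val x).2) (flag_act_subproof g x).

Lemma flag_act_inj (q : nat) (g : SL3Z) : injective (@flag_act q g).
Proof.
move=> x y /(congr1 val) [e1 e2]; apply: val_inj.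
have K V : vspace_act (invmx (redmx q (val g)))
             (vspace_act (redmx q (val g)) V) = V.
  by rewrite -vspace_actM mulVmx ?redmx_unit // vspace_act1.
by rewrite (surjective_pairing (val x)) (surjective_pairing (val y))
  -[(val x).1]K -[(val x).2]K e1 e2 !K.
Qed.

(* Permutations compose left to right, so Phi is a left action on flags:
   Phi (g h) x = Phi g (Phi h x), by vspace_actM. *)
Definition Phi (q : nat) (g : SL3Z) : {perm flag q} := perm (@flag_act_inj q g).

(* Main.v *)
(** Write [T] for the square root of [q].  There are about [q^3] integer
    matrices of determinant 1 and size [O(T)] obtained by completing a pair of
    rows with entries in [1, N], [N] ~ [T].  Two such matrices [g], [g']
    coincide on O(1) flags unless some [g' - a g] has rank at most 1 modulo [q],
    on O(q) flags unless they are proportional modulo [q] (hence equal), and on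
    O(q^3) flags always; a lattice point count shows that the exceptional pairs
    number at most [q^5 (log q)^2].  So for the average flag [x], the number of
    matrices taking [x] to [y] has, as a function of [y], an L^2 norm within a
    logarithm of that of a constant function.  By property (T), proved as in
    Burger and Shalom through the action of SL_2 on the characters of [F_q^2],
    one averaging step over elementary matrices contracts functions of mean zero
    on flags by a constant factor.  A small multiple of [log q] such steps
    multiplies sizes by [q^eps] at most, gains a power of [q], and leaves a
    function that vanishes on a negligible set only. *)
Require Import Defs.
From HB Require Import structures.
From mathcomp Require Import all_boot all_order all_algebra all_fingroup.
From mathcomp Require Import all_classical all_reals all_analysis.
From mathcomp Require Import ring lra zify.
Set Implicit Arguments.
Unset Strict Implicit.
Unset Printing Implicit Defensive.
Import Order.TTheory GRing.Theory Num.Theory.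
Import numFieldNormedType.Exports.
Local Open Scope ring_scope.

(** * Characters of F_q *)

(** The counting is shaped by one comparison. With [N ^ 2] of order [q] there are about [q ^ 6]
    ordered pairs of matrices, and a hit count of constant size also gives a second moment of order
    [q ^ 6], summed over all flags [x]. Bounding every off-diagonal pair by O(q) common images would
    give [q ^ 7]; hence the pairs with a difference of rank at most 1 must be shown to be rarer by a
    factor [q], up to logarithms. Summing over [x] is what turns common images into fixed flags of a
    single matrix. The third row of a completion is bounded but otherwise unknown, so degeneracy is
    read off the first two rows: rank at most 1 forces a linear relation between them, indexed by a
    point of the projective line. The loss of a logarithm squared is harmless because the
    contraction factor does not depend on [q]: relative property (T) contributes 340, and
    elimination by at most ten row operations contributes 2046. Finally, the missed pairs number at
    most [s ^ 2] times all pairs of flags, so Markov's inequality leaves a proportion [s] of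
    exceptional [x] and, for each other [x], a proportion [s] of exceptional [y]. *)

Section TrigonometricCharacters.
Variables (R : realType) (q : nat).
Hypothesis q_pr : prime q.

Definition angle (a : 'F_q) : R := (a : nat)%:R / q%:R * (pi *+ 2).
Definition cosq (a : 'F_q) : R := cos (angle a).
Definition sinq (a : 'F_q) : R := sin (angle a).

Let q_gt0 : 0 < q%:R :> R.
Proof. by rewrite ltr0n prime_gt0. Qed.

Let val_Fp_add (a b : 'F_q) : nat_of_ord (a + b)%R = ((a + b) %% q)%N.
Proof. by rewrite /=; congr (_ %% _)%N; apply: Fp_cast. Qed.

Lemma angleD a b : exists k : nat, angle a + angle b = angle (a + b) + pi *+ 2 *+ k.
Proof.
exists ((a + b) %/ q)%N; rewrite /angle val_Fp_add.
rewrite -mulrDl -mulrDl -natrD {1}(divn_eq (a + b)%N q) natrD natrM.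
rewrite mulrDl mulfK ?gt_eqF// mulrDl addrC; congr (_ + _).
by rewrite mulr_natl.
Qed.

Lemma cosqD a b : cosq (a + b) = cosq a * cosq b - sinq a * sinq b.
Proof.
have [k e] := angleD a b.
by rewrite /cosq /sinq -cosD e (periodicn (@cosD2pi R)).
Qed.

Lemma sinqD a b : sinq (a + b) = sinq a * cosq b + cosq a * sinq b.
Proof.
have [k e] := angleD a b.
by rewrite /cosq /sinq -sinD e (periodicn (@sinD2pi R)).
Qed.

Lemma cosq0 : cosq 0 = 1.
Proof. by rewrite /cosq /angle /= !mul0r cos0. Qed.

Lemma sinq0 : sinq 0 = 0.
Proof. by rewrite /sinq /angle /= !mul0r sin0. Qed.

Lemma cosq2Dsinq2 a : cosq a ^+ 2 + sinq a ^+ 2 = 1.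
Proof. exact: cos2Dsin2. Qed.

Lemma cosq_le1 a : cosq a <= 1.
Proof. exact: cos_le1. Qed.

(** The addition laws at [a + (- a) = 0] form a linear system of determinant
    [cosq a ^+ 2 + sinq a ^+ 2 = 1] for the values at [- a]; solving it avoids computing the
    representative of [- a]. *)
Lemma cosqN a : cosq (- a) = cosq a.
Proof.
have := cosqD a (- a); have := sinqD a (- a); rewrite subrr cosq0 sinq0.
have := cosq2Dsinq2 a => h1 h2 h3.
have : cosq a * (cosq a * cosq (- a) - sinq a * sinq (- a)) +
  sinq a * (sinq a * cosq (- a) + cosq a * sinq (- a)) =
  (cosq a ^+ 2 + sinq a ^+ 2) * cosq (- a) by ring.
by rewrite -h2 -h3 h1 => e; rewrite -[LHS]mul1r -e; ring.
Qed.

Lemma sinqN a : sinq (- a) = - sinq a.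
Proof.
have := cosqD a (- a); have := sinqD a (- a); rewrite subrr cosq0 sinq0.
have := cosq2Dsinq2 a => h1 h2 h3.
have : cosq a * (sinq a * cosq (- a) + cosq a * sinq (- a)) -
  sinq a * (cosq a * cosq (- a) - sinq a * sinq (- a)) =
  (cosq a ^+ 2 + sinq a ^+ 2) * sinq (- a) by ring.
by rewrite -h2 -h3 h1 => e; rewrite -[LHS]mul1r -e; ring.
Qed.

(** For nonzero [a] half the angle lies strictly between 0 and [pi], where the sine is positive,
    whereas [cosq a = 1] forces the squared cosine of the half angle to be 1. *)
Lemma cosq_eq1 a : cosq a = 1 -> a = 0.
Proof.
move=> ca; apply/eqP; rewrite -val_eqE /=; apply/negPn/negP => a0.
have a_lt : (a < q)%N by have := ltn_ord a; rewrite [X in (_ < X)%N -> _](Fp_cast q_pr).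
have a_gt0 : 0 < (a : nat)%:R :> R by rewrite ltr0n lt0n.
have : cos (angle a / 2) ^+ 2 = 1.
  have := cos_mulr2n (angle a / 2); rewrite -(mulr_natr (angle a / 2)).
  by rewrite divfK ?pnatr_eq0// -/(cosq a) ca; lra.
have : 0 < sin (angle a / 2).
  apply: sin_gt0_pi; rewrite /angle -(mulr_natr pi) mulrA mulfK ?pnatr_eq0//.
  rewrite mulr_gt0 ?pi_gt0 ?divr_gt0 ?a_gt0//=.
  by rewrite gtr_pMl ?pi_gt0// ltr_pdivrMr// mul1r ltr_nat.
have := cos2Dsin2 (angle a / 2) => h1 h2 h3.
by move: h1; rewrite h3; nra.
Qed.

(** Multiplication by [a] only permutes the field. The sine sum vanishes by oddness; shifting by 1
    then multiplies the cosine sum by [cosq 1], which is not 1. *)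
Lemma sum_cosq_sinq a : a != 0 ->
  \sum_b cosq (b * a) = 0 /\ \sum_b sinq (b * a) = 0.
Proof.
move=> a0.
have rei (f : 'F_q -> R) : \sum_b f (b * a) = \sum_b f b.
  rewrite [RHS](reindex_inj (h := fun b => b * a))//.
  by move=> x y; apply: mulIf.
rewrite !rei.
have s0 : \sum_b sinq b = 0.
  have : \sum_b sinq b = - \sum_b sinq b.
    rewrite {1}(reindex_inj (@oppr_inj _)) -sumrN.
    by apply: eq_bigr => b _; rewrite sinqN.
  by lra.
split=> //.
have : \sum_b cosq b = cosq 1 * \sum_b cosq b.
  rewrite {1}(reindex_inj (addrI (1 : 'F_q))).
  under eq_bigr do rewrite cosqD.
  by rewrite big_split/= sumrN -!mulr_sumr s0 mulr0 subr0.
move=> h.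
have /eqP : (1 - cosq 1) * \sum_b cosq b = 0 by rewrite mulrBl -h; ring.
rewrite mulf_eq0 => /orP[|/eqP//]; rewrite subr_eq0 eq_sym => /eqP /cosq_eq1.
by move/eqP; rewrite oner_eq0.
Qed.

Lemma sum_cosq2 (a b : 'F_q) :
  \sum_(j : 'F_q * 'F_q) cosq (j.1 * a + j.2 * b) =
  if (a == 0) && (b == 0) then q%:R ^+ 2 else 0.
Proof.
transitivity (\sum_(j : 'F_q) \sum_(k : 'F_q)
   (cosq (j * a) * cosq (k * b) - sinq (j * a) * sinq (k * b))).
  by rewrite pair_big /=; apply: eq_bigr => -[j k] _ /=; rewrite cosqD.
under eq_bigr do rewrite big_split/= sumrN -!mulr_sumr.
rewrite big_split /= sumrN -!mulr_suml.
have card1 : \sum_(j : 'F_q) (1 : R) = q%:R.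
  by rewrite sumr_const card_Fp.
have [->|a0] := eqVneq a 0; have [->|b0] := eqVneq b 0 => /=.
- under eq_bigr do rewrite mulr0 cosq0.
  under [X in _ - X * _]eq_bigr do rewrite mulr0 sinq0.
  by rewrite big1_eq card1; ring.
- by have [-> ->] := sum_cosq_sinq b0; ring.
- by have [-> ->] := sum_cosq_sinq a0; ring.
- by have [-> ->] := sum_cosq_sinq a0; ring.
Qed.

End TrigonometricCharacters.

(** * A relative property (T) *)

Section RelativePropertyT.
Variables (R : realType) (q : nat).
Hypothesis q_pr : prime q.
Variables (X : finType) (n : 'F_q -> 'F_q -> X -> X) (a b : X -> X).
Hypothesis n0 : forall x, n 0 0 x = x.
Hypothesis nD : forall u v u' v' x, n (u + u') (v + v') x = n u v (n u' v' x).
Hypothesis an : forall u v x, a (n u v x) = n (u + v) v (a x).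
Hypothesis bn : forall u v x, b (n u v x) = n u (v + u) (b x).
Hypothesis a_inj : injective a.
Hypothesis b_inj : injective b.

Local Notation F := 'F_q.
Local Notation cs := (@cosq R q).
Local Notation sn := (@sinq R q).

Let dot (j u : F * F) : F := j.1 * u.1 + j.2 * u.2.

Definition cos_coef (f : X -> R) (j : F * F) (x : X) : R :=
  \sum_(u : F * F) cs (j.1 * u.1 + j.2 * u.2) * f (n u.1 u.2 x).
Definition sin_coef (f : X -> R) (j : F * F) (x : X) : R :=
  \sum_(u : F * F) sn (j.1 * u.1 + j.2 * u.2) * f (n u.1 u.2 x).
(** The two coefficients are the real and imaginary parts of a Fourier coefficient of [f] along the
    orbit of [x]. This is therefore [q ^ 4] times the squared norm of the component of [f] on which
    the translations [n] act by the character [j], up to conjugation. *)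
Definition spectral_mass (f : X -> R) (j : F * F) : R :=
  \sum_x (cos_coef f j x ^+ 2 + sin_coef f j x ^+ 2).
Local Notation nu := spectral_mass.

Lemma spectral_mass_ge0 f j : 0 <= nu f j.
Proof. by apply: sumr_ge0 => x _; rewrite addr_ge0 ?sqr_ge0. Qed.

Let n_inj u v : injective (n u v).
Proof.
apply: (can_inj (g := n (- u) (- v))) => x.
by rewrite -nD !addNr n0.
Qed.

Lemma spectral_mass_sum f :
  \sum_j nu f j = q%:R ^+ 4 * \sum_x f x ^+ 2.
Proof.
transitivity (\sum_x \sum_(u : F * F) q%:R ^+ 2 * f (n u.1 u.2 x) ^+ 2).
  rewrite exchange_big /=; apply: eq_bigr => x _.
  transitivity (\sum_(j : F * F) \sum_(u : F * F) \sum_(v : F * F)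
     cs (j.1 * (u.1 - v.1) + j.2 * (u.2 - v.2)) *
       (f (n u.1 u.2 x) * f (n v.1 v.2 x))).
    apply: eq_bigr => j _.
    rewrite /cos_coef /sin_coef !expr2 !big_distrlr /= -big_split /=.
    apply: eq_bigr => u _; rewrite -big_split /=; apply: eq_bigr => v _.
    have -> : j.1 * (u.1 - v.1) + j.2 * (u.2 - v.2) =
        dot j u + - dot j v by rewrite /dot; ring.
    rewrite cosqD// cosqN// sinqN// /dot; ring.
  rewrite exchange_big /=; apply: eq_bigr => u _.
  rewrite exchange_big /= (bigD1 u) //= [X in _ + X]big1 ?addr0 => [|v vu].
    rewrite -mulr_suml sum_cosq2// !subrr eqxx /=; ring.
  rewrite -mulr_suml sum_cosq2// !subr_eq0.
  case: ifP => [/andP[/eqP e1 /eqP e2]|]; last by rewrite mul0r.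
  by move: vu; rewrite (surjective_pairing u) (surjective_pairing v) e1 e2 eqxx.
rewrite exchange_big /=.
transitivity (\sum_(u : F * F) q%:R ^+ 2 * \sum_x f x ^+ 2).
  apply: eq_bigr => u _; rewrite -mulr_sumr; congr (_ * _).
  by rewrite [RHS](reindex_inj (@n_inj u.1 u.2)).
rewrite sumr_const card_prod card_Fp// -(mulr_natl (q%:R ^+ 2 * _)) natrM; ring.
Qed.

Lemma cos_coefB f g j x :
  cos_coef (fun x => g x - f x) j x = cos_coef g j x - cos_coef f j x.
Proof.
rewrite /cos_coef -sumrB; apply: eq_bigr => u _; ring.
Qed.

Lemma sin_coefB f g j x :
  sin_coef (fun x => g x - f x) j x = sin_coef g j x - sin_coef f j x.
Proof.
rewrite /sin_coef -sumrB; apply: eq_bigr => u _; ring.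
Qed.

(** Translation by [w] multiplies the complex coefficient by a number [z] of modulus 1, and
    [|z - 1| ^ 2 = 2 - 2 Re z]. *)
Lemma spectral_mass_diff f w j :
  nu (fun x => f (n w.1 w.2 x) - f x) j =
  (2 - 2 * cs (j.1 * w.1 + j.2 * w.2)) * nu f j.
Proof.
rewrite /spectral_mass mulr_sumr; apply: eq_bigr => x _.
rewrite cos_coefB sin_coefB -!/(dot _ _).
have shift (h : F -> R) : \sum_(u : F * F) h (dot j u) * f (n w.1 w.2 (n u.1 u.2 x))
   = \sum_(u : F * F) h (dot j u + - dot j w) * f (n u.1 u.2 x).
  rewrite [RHS](reindex_inj (addrI w)) /=; apply: eq_bigr => u _.
  rewrite -nD; congr (h _ * _); rewrite /dot /=; ring.
have -> : cos_coef (fun x => f (n w.1 w.2 x)) j x =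
    cs (dot j w) * cos_coef f j x + sn (dot j w) * sin_coef f j x.
  rewrite /cos_coef /sin_coef.
  rewrite [LHS](shift cs) !mulr_sumr -big_split /=; apply: eq_bigr => u _.
  rewrite cosqD// cosqN// sinqN// /dot; ring.
have -> : sin_coef (fun x => f (n w.1 w.2 x)) j x =
    cs (dot j w) * sin_coef f j x - sn (dot j w) * cos_coef f j x.
  rewrite /cos_coef /sin_coef.
  rewrite [LHS](shift sn) !mulr_sumr -sumrB /=; apply: eq_bigr => u _.
  rewrite sinqD// cosqN// sinqN// /dot; ring.
have := cosq2Dsinq2 R (dot j w).
set c := cs _; set s := sn _; set A := cos_coef _ _ _; set B := sin_coef _ _ _.
move=> cs1; have -> : 2 - 2 * c = (c ^+ 2 + s ^+ 2) + 1 - 2 * c by rewrite cs1; ring.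
ring.
Qed.

(** A shear of the translations acts on characters by its inverse transpose. *)
Lemma spectral_mass_a f j : nu (f \o a) j = nu f (j.1, j.2 - j.1).
Proof.
rewrite {2}/spectral_mass (reindex_inj a_inj); apply: eq_bigr => x _.
have phiI : injective (fun u : F * F => (u.1 - u.2, u.2)).
  by apply: (can_inj (g := fun u => (u.1 + u.2, u.2))) => -[x1 x2]; rewrite /= subrK.
congr (_ ^+ 2 + _ ^+ 2); rewrite /cos_coef /sin_coef (reindex_inj phiI) /=;
  apply: eq_bigr => u _; rewrite an subrK;
  by have -> : j.1 * (u.1 - u.2) + j.2 * u.2 =
               j.1 * u.1 + (j.2 - j.1) * u.2 by ring.
Qed.

Lemma spectral_mass_b f j : nu (f \o b) j = nu f (j.1 - j.2, j.2).
Proof.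
rewrite {2}/spectral_mass (reindex_inj b_inj); apply: eq_bigr => x _.
have phiI : injective (fun u : F * F => (u.1, u.2 - u.1)).
  by apply: (can_inj (g := fun u => (u.1, u.2 + u.1))) => -[x1 x2]; rewrite /= subrK.
congr (_ ^+ 2 + _ ^+ 2); rewrite /cos_coef /sin_coef (reindex_inj phiI) /=;
  apply: eq_bigr => u _; rewrite bn subrK;
  by have -> : j.1 * u.1 + j.2 * (u.2 - u.1) =
               (j.1 - j.2) * u.1 + j.2 * u.2 by ring.
Qed.

(** The factor [3 / 2] has to be below 2: a quadrant has two disjoint images under the shears, so
    twice its mass is compared with [3 / 2] of its own mass plus errors, and the inequality can be
    solved for it. *)
Lemma spectral_mass_perturb f g j :
  nu g j <= 3 / 2 * nu f j + 3 * nu (fun x => g x - f x) j.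
Proof.
rewrite /spectral_mass !mulr_sumr -big_split /=; apply: ler_sum => x _.
rewrite cos_coefB sin_coefB.
set A := cos_coef _ _ _; set B := cos_coef _ _ _.
set C := sin_coef _ _ _; set D := sin_coef _ _ _.
have h (y z : R) : y ^+ 2 <= 3 / 2 * z ^+ 2 + 3 * (y - z) ^+ 2.
  rewrite -subr_ge0.
  have -> : 3 / 2 * z ^+ 2 + 3 * (y - z) ^+ 2 - y ^+ 2 =
     2 * (y - 3 / 2 * z) ^+ 2 by field.
  by rewrite mulr_ge0 ?sqr_ge0.
by have := h A B; have := h C D; lra.
Qed.

Lemma spectral_mass_perturbN f g j :
  nu (fun x => g x - f x) j = nu (fun x => f x - g x) j.
Proof.
apply: eq_bigr => x _; rewrite !cos_coefB !sin_coefB; ring.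
Qed.

Variables (f : X -> R) (d : R).
Hypothesis n1f : \sum_x (f (n 1 0 x) - f x) ^+ 2 <= d.
Hypothesis n2f : \sum_x (f (n 0 1 x) - f x) ^+ 2 <= d.
Hypothesis af : \sum_x (f (a x) - f x) ^+ 2 <= d.
Hypothesis bf : \sum_x (f (b x) - f x) ^+ 2 <= d.

Let e := q%:R ^+ 4 * d.
Let m (P : pred (F * F)) := \sum_(j | P j) nu f j.

Let mU (P Q T : pred (F * F)) :
  (forall j, P j -> Q j || T j) -> m P <= m Q + m T.
Proof.
move=> PQT; rewrite /m big_mkcond [X in _ <= X + _]big_mkcond [X in _ <= _ + X]big_mkcond.
rewrite -big_split /=.
apply: ler_sum => j _.
have := PQT j; have := spectral_mass_ge0 f j.
by case: (P j) => nu0; case: (Q j); case: (T j) => //=; lra.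
Qed.

Let moves (phi : F * F -> F * F) := forall P Q : pred (F * F),
  (forall j, P j -> Q (phi j)) -> m P <= 3 / 2 * m Q + 3 * e.

Let movesI phi (err : F * F -> R) : injective phi ->
  (forall j, 0 <= err j) -> \sum_j err j <= e ->
  (forall j, nu f j <= 3 / 2 * nu f (phi j) + 3 * err j) -> moves phi.
Proof.
move=> phiI err0 erre nuphi P Q PQ.
apply: (@le_trans _ _ (\sum_(j | P j) (3 / 2 * nu f (phi j) + 3 * err j))).
  by apply: ler_sum => j _; apply: nuphi.
rewrite big_split /= -!mulr_sumr; apply: lerD; rewrite ler_pM2l//.
  rewrite /m [leRHS](reindex_inj phiI) big_mkcond [leRHS]big_mkcond /=.
  apply: ler_sum => j _; have := PQ j; case: (P j) => [/(_ isT) ->//|_].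
  by case: ifP => // _; apply: spectral_mass_ge0.
apply: le_trans erre; rewrite big_mkcond /=; apply: ler_sum => j _.
by case: ifP.
Qed.

Let err_le (s : X -> X) : \sum_x (f (s x) - f x) ^+ 2 <= d ->
  \sum_j nu (fun x => f (s x) - f x) j <= e.
Proof. by move=> h; rewrite spectral_mass_sum ler_wpM2l// exprn_ge0. Qed.

Let movesA : moves (fun j => (j.1, j.2 + j.1)).
Proof.
have phiI : injective (fun j : F * F => (j.1, j.2 + j.1)).
  by apply: (can_inj (g := fun u => (u.1, u.2 - u.1))) => -[x1 x2]; rewrite /= addrK.
apply: (movesI (err := fun j => nu (fun x => f (a x) - f x) (j.1, j.2 + j.1))) => //.
- by move=> j; apply: spectral_mass_ge0.
- by have := err_le af; rewrite (reindex_inj phiI).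
- move=> j; have := spectral_mass_perturb f (f \o a) (j.1, j.2 + j.1).
  by rewrite spectral_mass_a /= addrK -surjective_pairing.
Qed.

Let movesB : moves (fun j => (j.1 + j.2, j.2)).
Proof.
have phiI : injective (fun j : F * F => (j.1 + j.2, j.2)).
  by apply: (can_inj (g := fun u => (u.1 - u.2, u.2))) => -[x1 x2]; rewrite /= addrK.
apply: (movesI (err := fun j => nu (fun x => f (b x) - f x) (j.1 + j.2, j.2))) => //.
- by move=> j; apply: spectral_mass_ge0.
- by have := err_le bf; rewrite (reindex_inj phiI).
- move=> j; have := spectral_mass_perturb f (f \o b) (j.1 + j.2, j.2).
  by rewrite spectral_mass_b /= addrK -surjective_pairing.
Qed.

Let movesAV : moves (fun j => (j.1, j.2 - j.1)).
Proof.
apply: (movesI (err := fun j => nu (fun x => f (a x) - f x) j)).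
- by apply: (can_inj (g := fun u => (u.1, u.2 + u.1))) => -[x1 x2]; rewrite /= subrK.
- by move=> j; apply: spectral_mass_ge0.
- exact: err_le.
- move=> j; have := spectral_mass_perturb (f \o a) f j.
  by rewrite spectral_mass_a spectral_mass_perturbN.
Qed.

Let movesBV : moves (fun j => (j.1 - j.2, j.2)).
Proof.
apply: (movesI (err := fun j => nu (fun x => f (b x) - f x) j)).
- by apply: (can_inj (g := fun u => (u.1 + u.2, u.2))) => -[x1 x2]; rewrite /= subrK.
- by move=> j; apply: spectral_mass_ge0.
- exact: err_le.
- move=> j; have := spectral_mass_perturb (f \o b) f j.
  by rewrite spectral_mass_b spectral_mass_perturbN.
Qed.

Let far (j : F * F) := (cs j.1 <= 0) || (cs j.2 <= 0).

(** On [far] one of the two factors [2 - 2 * cs] is at least 2, so half the sum of the two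
    translation defects dominates the mass. *)
Let m_far : m far <= e.
Proof.
have e1 := err_le n1f; have e2 := err_le n2f.
have h : m far <= 2^-1 * (\sum_j nu (fun x => f (n 1 0 x) - f x) j
   + \sum_j nu (fun x => f (n 0 1 x) - f x) j).
  rewrite -big_split /= mulr_sumr /m big_mkcond /=; apply: ler_sum => j _.
  rewrite (spectral_mass_diff f (1, 0) j) (spectral_mass_diff f (0, 1) j) /=.
  rewrite !mulr0 !mulr1 addr0 add0r.
  have := spectral_mass_ge0 f j; have := cosq_le1 R j.1; have := cosq_le1 R j.2.
  by rewrite /far; case: ifP => [/orP[]|_]; nra.
by apply: le_trans h _; lra.
Qed.

(** With angles taken in [(- pi / 2, pi / 2)], [s = 1] selects two angles of the same sign and
    [s = -1] two angles of opposite signs. *)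
Let quadrant (s : R) (j : F * F) :=
  [&& 0 < cs j.1, 0 < cs j.2 & 0 < s * (sn j.1 * sn j.2)].
Let same_side (s : R) (j : F * F) := 0 < s * (sn j.1 * sn j.2).

(* In a quadrant both shears move the larger angle away from 0, so the images
   of the quadrant are disjoint subsets of [same_side s]. *)
Let m_quadrant (s : R) phi psi : s ^+ 2 = 1 -> moves phi -> moves psi ->
  (forall j, (phi j).2 = j.2) -> (forall j, (psi j).1 = j.1) ->
  (forall j, cs (phi j).1 = cs j.1 * cs j.2 - s * (sn j.1 * sn j.2)) ->
  (forall j, sn (phi j).1 = sn j.1 * cs j.2 + s * (cs j.1 * sn j.2)) ->
  (forall j, cs (psi j).2 = cs j.1 * cs j.2 - s * (sn j.1 * sn j.2)) ->
  (forall j, sn (psi j).2 = sn j.2 * cs j.1 + s * (cs j.2 * sn j.1)) ->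
  m (quadrant s) <= 15 * e /\ m (same_side s) <= 16 * e.
Proof.
move=> s2 mphi mpsi phi2 psi1 cphi sphi cpsi spsi.
pose U j := same_side s j && (cs j.1 < cs j.2).
pose V j := same_side s j && (cs j.2 < cs j.1).
have side (c1 c2 s1 s2' : R) : 0 < c1 -> 0 < c2 -> 0 < s * (s1 * s2') ->
    0 < s * ((s1 * c2 + s * (c1 * s2')) * s2').
  move=> c10 c20 ss.
  have -> : s * ((s1 * c2 + s * (c1 * s2')) * s2') =
     s * (s1 * s2') * c2 + s ^+ 2 * (c1 * s2' ^+ 2) by ring.
  have h1 := mulr_gt0 ss c20.
  have h2 : 0 <= c1 * s2' ^+ 2 by rewrite mulr_ge0 ?sqr_ge0 ?ltW.
  by rewrite s2 mul1r; lra.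
have hU : m (quadrant s) <= 3 / 2 * m U + 3 * e.
  apply: mphi => j /and3P[c1 c2 ss]; rewrite /U /same_side cphi sphi phi2 side//=.
  by have := cosq_le1 R j.1; nra.
have hV : m (quadrant s) <= 3 / 2 * m V + 3 * e.
  apply: mpsi => j /and3P[c1 c2 ss]; rewrite /V /same_side cpsi spsi psi1.
  rewrite [sn j.1 * _]mulrC side//=; last by rewrite [sn j.2 * _]mulrC.
  by have := cosq_le1 R j.2; nra.
have hUV : m U + m V <= m (same_side s).
  rewrite /m [X in X + _ <= _]big_mkcond [X in _ + X <= _]big_mkcond.
  rewrite [leRHS]big_mkcond -big_split /=.
  apply: ler_sum => j _; rewrite /U /V; have := spectral_mass_ge0 f j.
  by case: (same_side s j) => //=; case: ltgtP => //=; lra.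
have hS : m (same_side s) <= m (quadrant s) + m far.
  apply: mU => j; rewrite /same_side /quadrant /far => ->; rewrite andbT.
  by case: (ltP 0 (cs j.1)); case: (ltP 0 (cs j.2)).
by have := m_far; split; lra.
Qed.

Let sin_neq0 (j : F) : j != 0 -> 0 < cs j -> sn j != 0.
Proof.
move=> j0 cj; apply: contra_neq j0 => sj; apply: (@cosq_eq1 R _ q_pr).
have := cosq2Dsinq2 R j; rewrite sj expr0n /= addr0; nra.
Qed.

(** A nonzero character is in [far], in one of the two quadrants, or on an axis, from which a shear
    moves it into [same_side 1]. The masses add up to [1 + 15 + 15 + 27 + 27 = 85] times [e], with
    [27 = 3 / 2 * 16 + 3]; a translation multiplies each by at most [|z - 1| ^ 2 <= 4], whence
    340. *)
Theorem relative_property_T u v :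
  \sum_x (f (n u v x) - f x) ^+ 2 <= 340 * d.
Proof.
have q4 : 0 < q%:R ^+ 4 :> R by rewrite exprn_gt0 // ltr0n prime_gt0.
rewrite -(ler_pM2l q4) -spectral_mass_sum.
have [Qp Sp] : m (quadrant 1) <= 15 * e /\ m (same_side 1) <= 16 * e.
  apply: (m_quadrant _ movesB movesA) => // [|j|j|j|j] /=; first exact: expr1n.
  - by rewrite cosqD// mul1r.
  - by rewrite sinqD// mul1r.
  - by rewrite cosqD//; ring.
  - by rewrite sinqD//; ring.
have [Qm _] : m (quadrant (-1)) <= 15 * e /\ m (same_side (-1)) <= 16 * e.
  apply: (m_quadrant _ movesBV movesAV) => // [|j|j|j|j] /=; first by rewrite sqrrN expr1n.
  - by rewrite cosqD// cosqN// sinqN//; ring.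
  - by rewrite sinqD// cosqN// sinqN//; ring.
  - by rewrite cosqD// cosqN// sinqN//; ring.
  - by rewrite sinqD// cosqN// sinqN//; ring.
pose ax1 (j : F * F) := [&& j.1 != 0, j.2 == 0 & 0 < cs j.1].
pose ax2 (j : F * F) := [&& j.2 != 0, j.1 == 0 & 0 < cs j.2].
have h1 : m ax1 <= 3 / 2 * m (same_side 1) + 3 * e.
  apply: movesA => j /and3P[j1 /eqP j2 c1].
  rewrite /same_side /= j2 add0r mul1r -expr2 lt0r sqr_ge0 andbT sqrf_eq0.
  exact: sin_neq0.
have h2 : m ax2 <= 3 / 2 * m (same_side 1) + 3 * e.
  apply: movesB => j /and3P[j1 /eqP j2 c1].
  rewrite /same_side /= j2 add0r mul1r -expr2 lt0r sqr_ge0 andbT sqrf_eq0.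
  exact: sin_neq0.
pose P1 j := quadrant 1 j || quadrant (-1) j.
pose P2 j := ax1 j || ax2 j.
pose P3 j := P1 j || P2 j.
have k1 : m P1 <= m (quadrant 1) + m (quadrant (-1)) by apply: mU.
have k2 : m P2 <= m ax1 + m ax2 by apply: mU.
have k3 : m P3 <= m P1 + m P2 by apply: mU.
have k4 : m (fun j => j != 0) <= m far + m P3.
  apply: mU => j j0; rewrite /P3 /P1 /P2 /far /quadrant /ax1 /ax2.
  case: (ltP 0 (cs j.1)) => //= c1; case: (ltP 0 (cs j.2)) => //= c2.
  have [j1|j1] := eqVneq j.1 0; have [j2|j2] := eqVneq j.2 0; rewrite ?orbT//=.
    by move: j0; rewrite (surjective_pairing j) j1 j2 eqxx.
  have := mulf_neq0 (sin_neq0 j1 c1) (sin_neq0 j2 c2).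
  by rewrite neq_lt mul1r mulN1r oppr_gt0 !orbF => /orP[] ->; rewrite ?orbT.
have k5 : m (fun j => j != 0) <= 85 * e by have := m_far; lra.
apply: (@le_trans _ _ (4 * m (fun j => j != 0))); last by rewrite mulrCA -/e; lra.
rewrite /m [X in _ <= _ * X]big_mkcond mulr_sumr; apply: ler_sum => j _.
rewrite (spectral_mass_diff f (u, v) j) /=.
case: ifPn => [_|/negPn/eqP ->].
  rewrite ler_wpM2r ?spectral_mass_ge0//.
  have := cosq2Dsinq2 R (j.1 * u + j.2 * v); nra.
by rewrite /= !mul0r addr0 cosq0; lra.
Qed.

End RelativePropertyT.

(** * Spectral gap for elementary matrices *)

Lemma I3P (k : 'I_3) : [\/ k = 0, k = 1 | k = 2].
Proof.
by case: k => [[|[|[|//]]] lt]; [apply: Or31|apply: Or32|apply: Or33]; exact: val_inj.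
Qed.

Section ElementaryMatrices.
Variable S : comNzRingType.
Implicit Types (A B : 'M[S]_3) (i j k : 'I_3).

Lemma det_mx33 A : \det A =
  A 0 0 * (A 1 1 * A 2 2 - A 1 2 * A 2 1)
  - A 0 1 * (A 1 0 * A 2 2 - A 1 2 * A 2 0)
  + A 0 2 * (A 1 0 * A 2 1 - A 1 1 * A 2 0).
Proof.
rewrite (expand_det_row _ 0) !big_ord_recl big_ord0 /cofactor.
rewrite !(expand_det_row _ 0) !big_ord_recl !big_ord0 /cofactor !det_mx11 !mxE /=.
pose a (k l : nat) := A (inord k) (inord l).
have Aa i j : A i j = a i j by rewrite /a !inord_val.
move: a Aa => a Aa; rewrite !Aa /= /bump /= !exprD !expr1 !expr0; ring.
Qed.

Lemma eq_mx33 A B : A 0 0 = B 0 0 -> A 0 1 = B 0 1 -> A 0 2 = B 0 2 ->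
  A 1 0 = B 1 0 -> A 1 1 = B 1 1 -> A 1 2 = B 1 2 ->
  A 2 0 = B 2 0 -> A 2 1 = B 2 1 -> A 2 2 = B 2 2 -> A = B.
Proof.
move=> *; apply/matrixP => i j.
by case: (I3P i) => ->; case: (I3P j) => ->.
Qed.

Definition elem i j (t : S) : 'M[S]_3 := 1%:M + t *: delta_mx i j.

Lemma elem_mulE i j t A k l :
  (elem i j t *m A) k l = A k l + (if k == i then t * A j l else 0).
Proof.
rewrite mulmxDl mul1mx -scalemxAl !mxE; congr (_ + _).
rewrite (bigD1 j) //= big1 => [|m mj].
  by rewrite !mxE eqxx andbT addr0; case: (k == i); rewrite ?mul1r// mul0r mulr0.
by rewrite !mxE (negPf mj) andbF mul0r.
Qed.

Lemma det_elem i j t : i != j -> \det (elem i j t) = 1.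
Proof.
rewrite det_mx33; case: (I3P i) => ->; case: (I3P j) => -> // _; rewrite !mxE /=;
  rewrite !(mulr0, mulr1, mulr1n, mulr0n, addr0, add0r, mul0r, subr0, mul1r, oppr0) //.
Qed.

(** The unipotent radical of a maximal parabolic subgroup: for distinct indices, a copy of the plane
    in column [k], which [elem i j 1] and [elem j i 1] normalize, acting on it by the two shears. *)
Definition radical i j k (u v : S) : 'M[S]_3 :=
  1%:M + u *: delta_mx i k + v *: delta_mx j k.

Lemma radicalr0 i j k u : radical i j k u 0 = elem i k u.
Proof. by rewrite /radical scale0r addr0. Qed.

Lemma radical0r i j k u : radical i j k 0 u = elem j k u.
Proof. by rewrite /radical scale0r addr0. Qed.

Let deltaM i j k (l : 'I_3) :
  delta_mx i j *m delta_mx k l = (j == k)%:R *: delta_mx i l :> 'M[S]_3.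
Proof.
have [->|jk] := eqVneq j k; first by rewrite mul_delta_mx scale1r.
by rewrite mul_delta_mx_0// scale0r.
Qed.

Lemma radicalM i j k u v u' v' : i != k -> j != k ->
  radical i j k (u + u') (v + v') = radical i j k u v *m radical i j k u' v'.
Proof.
move=> ik jk; rewrite /radical !(mulmxDl, mulmxDr) !mul1mx !mulmx1.
rewrite -!scalemxAl -!scalemxAr !deltaM ![k == _]eq_sym (negPf ik) (negPf jk).
by rewrite !scale0r !scaler0 !addr0 !scalerDl; apply/matrixP => a b; rewrite !mxE; ring.
Qed.

Lemma elem_radical i j k u v : i != j -> i != k -> j != k ->
  elem i j 1 *m radical i j k u v = radical i j k (u + v) v *m elem i j 1.
Proof.
move=> ij ik jk; rewrite /radical /elem !(mulmxDl, mulmxDr) !mul1mx !mulmx1.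
rewrite -!scalemxAl -!scalemxAr !deltaM ![k == _]eq_sym ?[j == i]eq_sym.
rewrite ?(negPf ik) ?(negPf jk) (negPf ij) !eqxx !scale1r.
by rewrite !scale0r !scaler0 !addr0; apply/matrixP => a b; rewrite !mxE; ring.
Qed.

Lemma elem_radicalV i j k u v : i != j -> i != k -> j != k ->
  elem j i 1 *m radical i j k u v = radical i j k u (v + u) *m elem j i 1.
Proof.
move=> ij ik jk; rewrite /radical /elem !(mulmxDl, mulmxDr) !mul1mx !mulmx1.
rewrite -!scalemxAl -!scalemxAr !deltaM ![k == _]eq_sym ?[j == i]eq_sym.
rewrite ?(negPf ik) ?(negPf jk) (negPf ij) !eqxx !scale1r.
by rewrite !scale0r !scaler0 !addr0; apply/matrixP => a b; rewrite !mxE; ring.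
Qed.

End ElementaryMatrices.

Lemma radical_unit (S : comUnitRingType) (i j k : 'I_3) (u v : S) :
  i != k -> j != k -> radical i j k u v \in unitmx.
Proof.
move=> ik jk; apply: (@proj1 _ _ (@mulmx1_unit _ _ _ (radical i j k (- u) (- v)) _)).
by rewrite -radicalM// !subrr /radical !scale0r !addr0.
Qed.

(** Packages the output of the character argument so that what follows can be carried out over an
    abstract finite field instead of ['F_q]. *)
Definition relative_T (R : realType) (F : finFieldType) (K : R) : Prop :=
  forall (X : finType) (n : F -> F -> X -> X) (a b : X -> X),
  (forall x, n 0 0 x = x) ->
  (forall u v u' v' x, n (u + u') (v + v') x = n u v (n u' v' x)) ->
  (forall u v x, a (n u v x) = n (u + v) v (a x)) ->
  (forall u v x, b (n u v x) = n u (v + u) (b x)) ->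
  injective a -> injective b ->
  forall (f : X -> R) (d : R),
  \sum_x (f (n 1 0 x) - f x) ^+ 2 <= d ->
  \sum_x (f (n 0 1 x) - f x) ^+ 2 <= d ->
  \sum_x (f (a x) - f x) ^+ 2 <= d ->
  \sum_x (f (b x) - f x) ^+ 2 <= d ->
  forall u v, \sum_x (f (n u v x) - f x) ^+ 2 <= K * d.

Lemma relative_T_Fp (R : realType) (q : nat) :
  prime q -> relative_T 'F_q (340 : R).
Proof. by move=> q_pr X n a b *; apply: (relative_property_T q_pr (n := n)); eassumption. Qed.

Section Gap.
Variables (R : realType) (F : finFieldType).
Hypothesis FT : relative_T F (340 : R).
Variables (X : finType) (act : 'M[F]_3 -> X -> X).
Hypothesis act1 : forall x, act 1%:M x = x.
Hypothesis actM : forall A B x, A \in unitmx -> B \in unitmx ->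
  act (A *m B) x = act A (act B x).
Hypothesis act_trans : forall x y, exists2 A, \det A = 1 & act A x = y.

Implicit Types A B E : 'M[F]_3.

Lemma act_inj A : A \in unitmx -> injective (act A).
Proof.
move=> uA; apply: (can_inj (g := act (invmx A))) => x.
by rewrite -actM ?unitmx_inv// mulVmx.
Qed.

Lemma det1_unitmx A : \det A = 1 -> A \in unitmx.
Proof. by rewrite unitmxE => ->; apply: unitr1. Qed.

Lemma elem_unitmx i j (t : F) : i != j -> elem i j t \in unitmx.
Proof. by move=> ij; apply/det1_unitmx/det_elem. Qed.

Variable f : X -> R.

Definition defect (A : 'M[F]_3) : R := \sum_x (f (act A x) - f x) ^+ 2.

Lemma defect_ge0 A : 0 <= defect A.
Proof. by apply: sumr_ge0 => x _; apply: sqr_ge0. Qed.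

Lemma defect_step A E : A \in unitmx -> E \in unitmx ->
  defect A <= 2 * defect (E *m A) + 2 * defect E.
Proof.
move=> uA uE; rewrite {3}/defect (reindex_inj (act_inj uA)) /= /defect.
rewrite !mulr_sumr -big_split /=; apply: ler_sum => x _; rewrite actM//.
set y := f _; set z := f x; set w := f (act E _).
by have := sqr_ge0 ((w - z) + (w - y)); nra.
Qed.

Variable d : R.
Hypothesis d_elem : forall i j, i != j -> defect (elem i j 1) <= d.

(** With the third index [j], the matrix becomes the translation [(t, 0)] of a radical. The bound is
    uniform in [t], whereas writing it as a power of [elem i k 1] would lose a factor growing with
    [q]. *)
Lemma defect_elem i k t : i != k -> defect (elem i k t) <= 340 * d.
Proof.
move=> ik.
have [j /andP[ij jk]] : exists j, (i != j) && (j != k).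
  move: ik; case: (I3P i) => ->; case: (I3P k) => -> // _;
  by [exists 0 | exists 1 | exists 2].
have ji : j != i by rewrite eq_sym.
rewrite -(radicalr0 i j).
apply: (FT (n := fun v w => act (radical i j k v w))
  (a := act (elem i j 1)) (b := act (elem j i 1))).
- by move=> x; rewrite radicalr0 /elem scale0r addr0 act1.
- by move=> v w v' w' x; rewrite -actM ?radical_unit// -radicalM.
- by move=> v w x; rewrite -!actM ?elem_unitmx ?radical_unit// elem_radical.
- by move=> v w x; rewrite -!actM ?elem_unitmx ?radical_unit// elem_radicalV.
- exact/act_inj/elem_unitmx.
- exact/act_inj/elem_unitmx.
- by rewrite radicalr0; apply: d_elem.
- by rewrite radical0r; apply: d_elem.
- exact: d_elem.
- exact: d_elem.
Qed.

Let e := 340 * d.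
Let e_ge0 : 0 <= e.
Proof. exact: le_trans (defect_ge0 _) (@defect_elem 0 1 0 _). Qed.

(** The bound after [n] row operations: by [defect_step] each one turns a bound [D] into
    [2 * D + 2 * e], and the recursion starts at 0 for the identity. *)
Let near n A := defect A <= e * ((2 ^ n)%:R *+ 2 - 2).

Let near_step n i j t A : i != j -> \det A = 1 ->
  near n (elem i j t *m A) -> near n.+1 A.
Proof.
move=> ij /det1_unitmx uA; rewrite /near => h.
apply: le_trans (defect_step uA (elem_unitmx t ij)) _.
have := defect_elem t ij; rewrite -/e expnS natrM; lra.
Qed.

Let near_leq n A : near n A -> near n.+1 A.
Proof.
rewrite /near => h; apply: le_trans h _; rewrite ler_wpM2l// expnS natrM.
have : 0 <= (2 ^ n)%:R :> R by []; lra.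
Qed.

Let det_elemM i j t A : i != j -> \det A = 1 -> \det (elem i j t *m A) = 1 :> F.
Proof. by move=> ij; rewrite det_mulmx det_elem// mul1r. Qed.

Let near_unipotent A : \det A = 1 -> A 0 0 = 1 -> A 1 1 = 1 -> A 2 2 = 1 ->
  A 1 0 = 0 -> A 2 0 = 0 -> A 2 1 = 0 -> near 3 A.
Proof.
move=> dA a00 a11 a22 a10 a20 a21.
apply: (@near_step _ 0 1 (- A 0 1)) => //.
apply: (@near_step _ 0 2 (- (A 0 2 - A 0 1 * A 1 2))) => //; first exact: det_elemM.
apply: (@near_step _ 1 2 (- A 1 2)) => //; first by rewrite !det_elemM.
suff -> : elem 1 2 (- A 1 2) *m (elem 0 2 (- (A 0 2 - A 0 1 * A 1 2)) *m
    (elem 0 1 (- A 0 1) *m A)) = 1%:M.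
  rewrite /near /defect big1 => [|x _]; first by rewrite expn0 subrr mulr0.
  by rewrite act1 subrr expr0n.
apply: eq_mx33; rewrite !elem_mulE /= !mxE /= ?a00 ?a11 ?a22 ?a10 ?a20 ?a21; ring.
Qed.

Let near_col2 A : \det A = 1 -> A 0 0 = 1 -> A 1 0 = 0 -> A 2 0 = 0 ->
  A 1 1 = 1 -> near 4 A.
Proof.
move=> dA a00 a10 a20 a11.
apply: (@near_step _ 2 1 (- A 2 1)) => //.
apply: near_unipotent; rewrite ?det_elemM// !elem_mulE /= ?a00 ?a11 ?a10 ?a20; try ring.
by move: dA; rewrite det_mx33 a00 a10 a20 a11 => <-; ring.
Qed.

Let near_block A : \det A = 1 -> A 0 0 = 1 -> A 1 0 = 0 -> A 2 0 = 0 -> near 6 A.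
Proof.
move=> dA a00 a10 a20.
have nz B : \det B = 1 -> B 0 0 = 1 -> B 1 0 = 0 -> B 2 0 = 0 ->
    B 2 1 != 0 -> near 5 B.
  move=> dB b00 b10 b20 b21.
  apply: (@near_step _ 1 2 ((1 - B 1 1) / B 2 1)) => //.
  apply: near_col2; rewrite ?det_elemM// !elem_mulE /= ?b00 ?b10 ?b20; try ring.
  by field.
have [a21|a21] := eqVneq (A 2 1) 0; last exact/near_leq/nz.
apply: (@near_step _ 2 1 1) => //.
apply: nz; rewrite ?det_elemM// !elem_mulE /= ?a00 ?a10 ?a20 ?a21; try ring.
rewrite add0r mul1r; apply/eqP => a11.
by move/eqP: dA; rewrite det_mx33 a00 a10 a20 a21 a11 !(mul0r, mulr0, subr0, addr0) eq_sym oner_eq0.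
Qed.

(** Gaussian elimination by transvections alone: a nonzero entry below a pivot is used to make the
    pivot 1, after at most one operation that creates such an entry. Ten operations suffice, and
    [2046 = 2 ^ 11 - 2]. *)
Lemma defect_det1 A : \det A = 1 -> defect A <= 2046 * e.
Proof.
move=> dA; suff : near 10 A by rewrite /near => /le_trans; apply; rewrite mulrC; lra.
have c1 B : \det B = 1 -> B 0 0 = 1 -> near 8 B.
  move=> dB b00.
  apply: (@near_step _ 1 0 (- B 1 0)) => //.
  apply: (@near_step _ 2 0 (- B 2 0)) => //; first exact: det_elemM.
  by apply: near_block; rewrite ?det_elemM// !elem_mulE /= ?b00; ring.
have c2 B : \det B = 1 -> (B 1 0 != 0) || (B 2 0 != 0) -> near 9 B.
  move=> dB /orP[] b0.
    apply: (@near_step _ 0 1 ((1 - B 0 0) / B 1 0)) => //.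
    by apply: c1; rewrite ?det_elemM// !elem_mulE /=; field.
  apply: (@near_step _ 0 2 ((1 - B 0 0) / B 2 0)) => //.
  by apply: c1; rewrite ?det_elemM// !elem_mulE /=; field.
have [b|] := boolP ((A 1 0 != 0) || (A 2 0 != 0)); first exact/near_leq/c2.
rewrite negb_or !negbK => /andP[/eqP a10 /eqP a20].
apply: (@near_step _ 1 0 1) => //.
apply: c2; rewrite ?det_elemM// !elem_mulE /= a10 add0r mul1r.
apply/orP; left; apply/eqP => a00.
by move/eqP: dA; rewrite det_mx33 a00 a10 a20 !(mul0r, mulr0, subr0, addr0) eq_sym oner_eq0.
Qed.

(** Average the defect over all matrices of determinant 1. The cross term contains the group average
    of [f], which is constant by transitivity, hence 0; so the mean defect is at least the squared
    norm of [f]. *)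
Lemma spectral_gap : \sum_x f x = 0 -> \sum_x f x ^+ 2 <= 2046 * (340 * d).
Proof.
move=> f0.
pose G := [set A : 'M[F]_3 | \det A == 1].
have G1 : 1%:M \in G by rewrite inE det1.
have Gu A : A \in G -> A \in unitmx by rewrite inE => /eqP /det1_unitmx.
pose g x := \sum_(A in G) f (act A x).
have ginv B x : \det B = 1 -> g (act B x) = g x.
  move=> dB; have uB := det1_unitmx dB; rewrite /g.
  have mI : injective (fun A : 'M[F]_3 => A *m B).
    by apply: (can_inj (g := fun A => A *m invmx B)) => A; rewrite mulmxK.
  rewrite [RHS](reindex_inj mI) /=; apply: eq_big => A.
    by rewrite !inE det_mulmx dB mulr1.
  by move=> GA; rewrite actM// Gu.
have gsum : \sum_x g x = 0.
  rewrite /g exchange_big big1 //= => A GA; rewrite -[RHS]f0.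
  by rewrite [RHS](reindex_inj (act_inj (Gu _ GA))).
have g0 x : g x = 0.
  have gc y : g y = g x by have [A dA <-] := act_trans x y; apply: ginv.
  move: gsum; rewrite (eq_bigr _ (fun y _ => gc y)) sumr_const => /eqP.
  rewrite mulrn_eq0 => /orP[/eqP X0|/eqP//].
  by move: (card0_eq X0 x); rewrite inE.
have G_gt0 : 0 < #|G|%:R :> R.
  by rewrite ltr0n card_gt0; apply/finset.set0Pn; exists 1%:M.
rewrite -(ler_pM2l G_gt0).
apply: (@le_trans _ _ (\sum_(A in G) defect A)).
  rewrite /defect exchange_big mulr_sumr /=; apply: ler_sum => x _.
  have -> : \sum_(A in G) (f (act A x) - f x) ^+ 2 =
     \sum_(A in G) f (act A x) ^+ 2 - 2 * f x * g x + #|G|%:R * f x ^+ 2.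
    have -> : #|G|%:R * f x ^+ 2 = \sum_(A in G) f x ^+ 2.
      by rewrite sumr_const mulr_natl.
    rewrite /g mulr_sumr -sumrB -big_split /=.
    by apply: eq_bigr => A _; ring.
  by rewrite g0 mulr0 subr0 lerDr sumr_ge0// => A _; apply: sqr_ge0.
apply: (@le_trans _ _ (\sum_(A in G) 2046 * e)).
  by apply: ler_sum => A; rewrite inE => /eqP; apply: defect_det1.
rewrite sumr_const -(mulr_natl (2046 * e)) ler_pM2l// /e.
Qed.

End Gap.

(** * Contraction by one averaging step *)

Section Averaging.
Variables (R : realType) (F : finFieldType).
Hypothesis FT : relative_T F (340 : R).
Variables (X : finType) (act : 'M[F]_3 -> X -> X).
Hypothesis act1 : forall x, act 1%:M x = x.
Hypothesis actM : forall A B x, A \in unitmx -> B \in unitmx ->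
  act (A *m B) x = act A (act B x).
Hypothesis act_trans : forall x y, exists2 A, \det A = 1 & act A x = y.

(** Diagonal indices give the identity, which makes the averaging lazy: comparing the other terms
    with this one rules out eigenvalues near -1. *)
Definition gen (S : comNzRingType) (s : 'I_3 * 'I_3) : 'M[S]_3 :=
  if s.1 == s.2 then 1%:M else elem s.1 s.2 1.

Definition average (f : X -> R) (x : X) : R :=
  9^-1 * \sum_s f (act (gen F s) x).

Lemma gen_unitmx s : gen F s \in unitmx.
Proof. by rewrite /gen; case: eqVneq => [_|/elem_unitmx ->//]; apply: unitmx1. Qed.

Lemma average_sum f : \sum_x average f x = \sum_x f x.
Proof.
rewrite /average -mulr_sumr exchange_big /=.
under eq_bigr => s _.
  rewrite -(reindex_inj (act_inj act1 actM (gen_unitmx s)) (P := xpredT) (F := f)).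
  over.
by rewrite sumr_const card_prod card_ord -(mulr_natl (\sum_x _)) mulrA mulVf ?mul1r// pnatr_eq0.
Qed.

Definition gap_factor : R := 1 - 1 / (162 * (2046 * 340)).

Lemma average_contract f : \sum_x f x = 0 ->
  \sum_x average f x ^+ 2 <= gap_factor * \sum_x f x ^+ 2.
Proof.
move=> f0; pose D := \sum_s defect act f (gen F s).
have gapD : \sum_x f x ^+ 2 <= 2046 * (340 * D).
  apply: (spectral_gap FT act1 actM act_trans) => // i j ij.
  rewrite /D (bigD1 (i, j)) //= {1}/gen /= (negPf ij) lerDl sumr_ge0// => s _.
  exact: defect_ge0.
suff : \sum_x average f x ^+ 2 <= \sum_x f x ^+ 2 - D / 162.
  by rewrite /gap_factor; lra.
have sqsum s : \sum_x f (act (gen F s) x) ^+ 2 = \sum_x f x ^+ 2.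
  by rewrite [RHS](reindex_inj (act_inj act1 actM (gen_unitmx s))).
have pt x : average f x ^+ 2 <= 9^-1 * \sum_s f (act (gen F s) x) ^+ 2
    - (\sum_s (f (act (gen F s) x) - f x) ^+ 2) / 162.
  pose a s := f (act (gen F s) x).
  have a0 : f x = a (0, 0) by rewrite /a /gen eqxx act1.
  rewrite /average a0 -!/(a _) exprMn.
  have c9 : \sum_(s : 'I_3 * 'I_3) (1 : R) = 9.
    by rewrite sumr_const card_prod card_ord.
  (* The defect in Jensen's inequality for nine terms is the sum over pairs divided by
     [162 = 2 * 9 ^ 2]; of these pairs only those with [t = (0, 0)], where [a t] is [f x], are
     kept. *)
  have : \sum_s \sum_t (a s - a t) ^+ 2 =
     18 * \sum_s a s ^+ 2 - 2 * (\sum_s a s) ^+ 2.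
    have -> : \sum_(s : 'I_3 * 'I_3) \sum_(t : 'I_3 * 'I_3) (a s - a t) ^+ 2 =
        \sum_(s : 'I_3 * 'I_3) \sum_(t : 'I_3 * 'I_3) (a s ^+ 2 * 1) +
        \sum_(s : 'I_3 * 'I_3) \sum_(t : 'I_3 * 'I_3) (1 * a t ^+ 2) -
        2 * \sum_(s : 'I_3 * 'I_3) \sum_(t : 'I_3 * 'I_3) a s * a t.
      rewrite -big_split mulr_sumr -sumrB /=; apply: eq_bigr => s _.
      rewrite -big_split mulr_sumr -sumrB /=; apply: eq_bigr => t _; ring.
    by rewrite -!big_distrlr /= c9; ring.
  have : \sum_s (a s - a (0, 0)) ^+ 2 <= \sum_s \sum_t (a s - a t) ^+ 2.
    apply: ler_sum => s _; rewrite (bigD1 (0, 0)) //= lerDl sumr_ge0// => t _.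
    exact: sqr_ge0.
  lra.
apply: le_trans (ler_sum _ (fun x _ => pt x)) _.
rewrite sumrB -mulr_sumr exchange_big /= (eq_bigr _ (fun s _ => sqsum s)).
rewrite sumr_const card_prod card_ord -(mulr_natl (\sum_x _)) mulrA mulVf ?pnatr_eq0//.
by rewrite mul1r lerD2l lerN2 -mulr_suml /D /defect [X in _ <= X / _]exchange_big.
Qed.

End Averaging.

(** * Harmonic sums and counting *)

Section Harmonic.
Variable R : realType.

Definition harmonic_sum (n : nat) : R := \sum_(1 <= i < n.+1) i%:R^-1.

(** Each dyadic block contributes at most 1. *)
Lemma harmonic_sum_le n : harmonic_sum n <= (trunc_log 2 n).+1%:R.
Proof.
have h k : \sum_(1 <= i < 2 ^ k) i%:R^-1 <= k%:R :> R.
  elim: k => [|k IH]; first by rewrite big_geq.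
  rewrite (big_cat_nat (n := 2 ^ k)) ?expn_gt0//=; last by rewrite leq_exp2l.
  rewrite -natr1 lerD//.
  apply: (@le_trans _ _ (\sum_(2 ^ k <= i < 2 ^ k.+1) (2 ^ k)%:R^-1)).
    rewrite !big_nat; apply: ler_sum => i /andP[ki _].
    by rewrite lef_pV2 ?posrE ?ltr0n ?ler_nat ?expn_gt0//; apply: leq_trans ki; rewrite expn_gt0.
  rewrite sumr_const_nat expnS mul2n -addnn addnK -(mulr_natl (_^-1)) mulfV//.
have nL : (n < 2 ^ (trunc_log 2 n).+1)%N by apply: trunc_log_ltn.
apply: le_trans (h _); rewrite /harmonic_sum.
rewrite [leRHS](big_cat_nat (n := n.+1))//= lerDl sumr_ge0// => i _.
Qed.

Lemma harmonic_sum_ge1 n : (0 < n)%N -> 1 <= harmonic_sum n.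
Proof.
move=> n0; rewrite /harmonic_sum big_ltn// invr1 lerDl sumr_ge0// => i _.
Qed.

Lemma sum_invsq_le n : \sum_(2 <= p < n.+1) (p%:R ^+ 2)^-1 <= 3 / 4 :> R.
Proof.
(* Telescoping comparison, started at [p = 2] with equality. *)
have h k : \sum_(2 <= p < k.+3) (p%:R ^+ 2)^-1 <= 3 / 4 - (k.+2%:R)^-1 :> R.
  elim: k => [|k IH]; first by rewrite big_nat1; lra.
  rewrite big_nat_recr//=; apply: le_trans (lerD IH (lexx _)) _.
  rewrite -(natr1 k.+2); set x : R := k.+2%:R.
  have x0 : 0 < x by rewrite ltr0n.
  rewrite -subr_ge0.
  have -> : 3 / 4 - (x + 1)^-1 - (3 / 4 - x^-1 + ((x + 1) ^+ 2)^-1) =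
     (x * (x + 1) ^+ 2)^-1.
    field; rewrite !gt_eqF//; lra.
  by rewrite invr_ge0 mulr_ge0 ?sqr_ge0 ?ltW.
case: n => [|[|n]]; try by rewrite big_geq//; lra.
by apply: le_trans (h n) _; rewrite gerBl invr_ge0.
Qed.

(** The total in the sieve bounds below, where any constant less than 1 would leave a positive
    proportion. The main term gives [3 / 4]; the rounding gives at most [1 / 8], and 256 is the
    power of two from which [16 * harmonic_sum n + 8 <= n] follows from the logarithmic bound. *)
Lemma sum_sqr_quotient_le n : (256 <= n)%N ->
  \sum_(2 <= p < n.+1) ((n %/ p).+1%:R) ^+ 2 <= 7 / 8 * n%:R ^+ 2 :> R.
Proof.
move=> n256.
set x : R := n%:R; have x256 : 256 <= x by rewrite ler_nat.
have hh : 16 * harmonic_sum n + 8 <= x.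
  have [L256 nL] : (8 <= trunc_log 2 n)%N /\ (2 ^ trunc_log 2 n <= n)%N.
    by rewrite trunc_logP ?(leq_trans _ n256)//; split=> //; apply: (@trunc_log_max 2 n 8).
  apply: (@le_trans _ _ (16 * (trunc_log 2 n).+1%:R + 8)).
    by have := harmonic_sum_le n; lra.
  apply: (@le_trans _ _ (2 ^ trunc_log 2 n)%:R); last by rewrite ler_nat.
  rewrite -natrM -natrD ler_nat; move: (trunc_log 2 n) L256 => L; clear.
  elim: L => // L IH; rewrite leq_eqVlt => /orP[/eqP <-//|/IH].
  rewrite expnS; lia.
apply: (@le_trans _ _ (\sum_(2 <= p < n.+1)
    (x ^+ 2 * (p%:R ^+ 2)^-1 + (2 * x * p%:R^-1 + 1)))).
  rewrite !big_nat; apply: ler_sum => p /andP[p2 _].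
  have p0 : 0 < p%:R :> R by rewrite ltr0n ltnW.
  have -> : x ^+ 2 * (p%:R ^+ 2)^-1 + (2 * x * p%:R^-1 + 1) = (x / p%:R + 1) ^+ 2.
    by field; rewrite gt_eqF.
  rewrite ler_sqr ?nnegrE ?addr_ge0 ?divr_ge0// -natr1 lerD2r ler_pdivlMr//.
  by rewrite -natrM ler_nat leq_trunc_div.
rewrite big_split -mulr_sumr big_split /= -mulr_sumr sumr_const_nat subSS.
have h1 : \sum_(2 <= i < n.+1) i%:R^-1 <= harmonic_sum n :> R.
  rewrite /harmonic_sum (big_ltn (m := 1)) ?ltnS; last exact: leq_trans n256.
  by rewrite lerDr invr_ge0.
have h2 : (n - 1)%:R <= x :> R by rewrite ler_nat leq_subr.
have h3 := sum_invsq_le n.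
have h4 : x * \sum_(2 <= i < n.+1) i%:R^-1 <= x * harmonic_sum n.
  by rewrite ler_wpM2l.
have h5 : x ^+ 2 * \sum_(2 <= p < n.+1) (p%:R ^+ 2)^-1 <= x ^+ 2 * (3 / 4).
  by rewrite ler_wpM2l// sqr_ge0.
nra.
Qed.

End Harmonic.

Section Counting.
Local Open Scope nat_scope.

Lemma card_le_inj (A B : finType) (P : pred A) (Q : pred B) (f : A -> B) :
  {in P &, injective f} -> (forall x, P x -> Q (f x)) -> #|P| <= #|Q|.
Proof.
move=> fI PQ; rewrite -(@card_in_image _ _ f P fI).
apply/fintype.subset_leq_card/fintype.subsetP => _ /fintype.imageP[x Px ->].
exact: PQ.
Qed.

Lemma card_le_sub (A : finType) (P Q : pred A) :
  (forall x, P x -> Q x) -> #|P| <= #|Q|.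
Proof. by move=> PQ; apply/fintype.subset_leq_card/fintype.subsetP. Qed.

Lemma card_pair_le (A B : finType) (S : pred (A * B)) (T : pred A) (M : nat) :
  (forall a b, S (a, b) -> T a) -> (forall a, #|[pred b | S (a, b)]| <= M) ->
  #|S| <= #|T| * M.
Proof.
move=> ST SM.
have -> : #|S| = \sum_a \sum_b if S (a, b) then 1 else 0.
  by rewrite pair_bigA /= -sum1_card big_mkcond; apply: eq_bigr => -[a b].
rewrite -sum_nat_const [leqRHS]big_mkcond /=; apply: leq_sum => a _.
rewrite -big_mkcond sum1_card; case: ifPn => [_|Ta]; first exact: SM.
by rewrite leqn0; apply/eqP/eq_card0 => b; rewrite !inE; apply: contraNF Ta => /ST.
Qed.

Lemma card_swap_le (A B : finType) (S : pred (A * B)) (M : nat) :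
  (forall b, #|[pred a | S (a, b)]| <= M) -> #|S| <= #|B| * M.
Proof.
move=> SM.
apply: (@leq_trans #|[pred u : B * A | S (u.2, u.1)]|).
  by apply: (card_le_inj (f := fun u => (u.2, u.1))) => [[a b] [c d] _ _ [-> ->]|[]].
exact: (@card_pair_le _ _ [pred u : B * A | S (u.2, u.1)] xpredT).
Qed.

Lemma card_congr_le (A : finType) (N p : nat) (E : pred A) (f : A -> 'I_N) :
  0 < p -> {in E &, injective f} ->
  (forall i j, E i -> E j -> (p%:Z %| ((f i)%:Z - (f j)%:Z)%R)%Z) ->
  #|E| <= (N %/ p).+1.
Proof.
move=> p0 fI Ep.
pose g i : 'I_(N %/ p).+1 := inord (f i %/ p).
have gE i : g i = f i %/ p :> nat.
  by rewrite inordK// ltnS leq_div2r// ltnW.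
rewrite -[leqRHS]card_ord -(@card_in_image _ _ g E); first exact: max_card.
move=> i j Ei Ej /(congr1 val) /=; rewrite !gE => eij.
apply/fI => //; apply/val_inj.
rewrite /= (divn_eq (f i) p) (divn_eq (f j) p) eij; congr (_ + _).
by have := Ep i j Ei Ej; rewrite -eqz_mod_dvd !modz_nat => /eqP[].
Qed.

Lemma union_bound (T : finType) (B : pred T) (N : nat) (Bp : nat -> pred T) :
  (forall x, B x -> exists p, [/\ 1 < p, p <= N & Bp p x]) ->
  #|B| <= \sum_(2 <= p < N.+1) #|Bp p|.
Proof.
move=> h.
have -> : \sum_(2 <= p < N.+1) #|Bp p| =
    \sum_(2 <= p < N.+1) \sum_x if Bp p x then 1 else 0.
  by apply: eq_bigr => p _; rewrite -sum1_card big_mkcond.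
rewrite -sum1_card big_mkcond exchange_big /=; apply: leq_sum => x _.
case: ifPn => // /h[p [p1 pN Bpx]].
by rewrite (bigD1_seq p) ?iota_uniq ?mem_index_iota ?p1 ?ltnS//= Bpx.
Qed.

End Counting.

(** * Admissible pairs of rows *)

Section Rows.
Variable N : nat.
Local Notation I := 'I_N.
Local Notation row := (I * I * I)%type.
Implicit Types (r s : row) (p : nat).

Definition ent (i : I) : int := i.+1%:Z.

Definition minor12 r s : int := ent r.1.1 * ent s.1.2 - ent s.1.1 * ent r.1.2.
Definition minor13 r s : int := ent r.1.1 * ent s.2 - ent s.1.1 * ent r.2.
Definition minor23 r s : int := ent r.1.2 * ent s.2 - ent s.1.2 * ent r.2.

Definition head_coprime r := coprimez (ent r.1.1) (ent r.1.2).

(** Coprimality of the 2 by 2 minors is the condition for a completion of determinant 1; the nonzero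
    first minor is what the third row is later reduced by. *)
Definition primitive_pair r s := (minor12 r s != 0) &&
  (gcdz (minor12 r s) (gcdz (minor13 r s) (minor23 r s)) == 1).

Definition dependent_mod p r s := [&& (p%:Z %| minor12 r s)%Z,
  (p%:Z %| minor13 r s)%Z & (p%:Z %| minor23 r s)%Z].

Lemma dependent_modP p r s : reflect [/\ (p%:Z %| minor12 r s)%Z,
  (p%:Z %| minor13 r s)%Z & (p%:Z %| minor23 r s)%Z] (dependent_mod p r s).
Proof. exact: and3P. Qed.

Lemma ent_gt0 i : 0 < ent i. Proof. by rewrite ltz_nat. Qed.

Lemma ent_le i : ent i <= N%:Z.
Proof. by rewrite /ent lez_nat; apply: ltn_ord. Qed.

Lemma ent_sub_dvd p (i j : I) : (p%:Z %| ent i - ent j)%Z = (p%:Z %| i%:Z - j%:Z)%Z.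
Proof.
by have -> : ent i - ent j = i%:Z - j%:Z by rewrite /ent (intS i) (intS j); ring.
Qed.

Lemma dvd_solution p (x d : int) (i j : I) : prime p -> ~~ (p%:Z %| x)%Z ->
  (p%:Z %| x * ent i - d)%Z -> (p%:Z %| x * ent j - d)%Z ->
  (p%:Z %| i%:Z - j%:Z)%Z.
Proof.
move=> pp px hi hj; rewrite -ent_sub_dvd.
rewrite -(@Gauss_dvdzr _ x); last first.
  by rewrite /coprimez /gcdz eqz_nat -/(coprime _ _) prime_coprime.
have -> : x * (ent i - ent j) = (x * ent i - d) - (x * ent j - d) by ring.
exact: rpredB.
Qed.

(** An entry of [r] invertible modulo [p] among the first two makes two entries of [s] determined
    modulo [p] by the remaining one. *)
Lemma card_dependent_mod p r : prime p ->
  ~~ ((p%:Z %| ent r.1.1)%Z && (p%:Z %| ent r.1.2)%Z) ->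
  (#|[pred s | dependent_mod p r s]| <= N * (N %/ p).+1 * (N %/ p).+1)%N.
Proof.
move=> pp; rewrite negb_and => pr; have p0 := prime_gt0 pp.
apply: (@leq_trans (#|[pred u : I * I | (p%:Z %| minor12 r (u, u.1))%Z]| *
   (N %/ p).+1)%N).
  apply: card_pair_le; first by move=> [x y] z; case/dependent_modP => h _ _; exact: h.
  move=> [x y]; apply: (card_congr_le (f := id)) => // i j.
  move=> /dependent_modP[_ i13 i23] /dependent_modP[_ j13 j23].
  case/orP: pr => pr; first exact: dvd_solution pp pr i13 j13.
  exact: dvd_solution pp pr i23 j23.
rewrite leq_mul2r; apply/orP; right; case/orP: pr => pr.
  rewrite -[X in (_ <= X * _)%N]card_ord.
  apply: (@card_pair_le _ _ _ xpredT) => // x.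
  apply: (card_congr_le (f := id)) => // i j hi hj.
  exact: dvd_solution pp pr hi hj.
rewrite -[X in (_ <= X * _)%N]card_ord.
apply: card_swap_le => y; apply: (card_congr_le (f := id)) => // i j hi hj.
have h (k : I) : (p%:Z %| minor12 r ((k, y), y))%Z ->
    (p%:Z %| ent r.1.2 * ent k - ent r.1.1 * ent y)%Z.
  by rewrite -rpredN opprB /= mulrC.
exact: dvd_solution pp pr (h i hi) (h j hj).
Qed.

Lemma minor12_lt r s : `|minor12 r s| < (N ^ 2)%:Z.
Proof.
rewrite -mulnn PoszM /minor12.
have le (i j : I) : 0 < ent i * ent j <= N%:Z * N%:Z.
  by rewrite mulr_gt0 ?ent_gt0// ler_pM ?ent_le// ltW ?ent_gt0.
have /andP[] := le r.1.1 s.1.2; have /andP[] := le s.1.1 r.1.2.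
by rewrite ltr_norml; lia.
Qed.

Lemma card_zero_minor r : (#|[pred s | minor12 r s == 0]| <= N * N)%N.
Proof.
apply: (@leq_trans (#|[pred u : I * I | minor12 r (u, u.1) == 0]| * N)%N).
  rewrite -[X in (_ <= _ * X)%N]card_ord.
  apply: card_pair_le; last by move=> u; apply: max_card.
  by move=> [x y] z.
rewrite leq_mul2r; apply/orP; right.
rewrite -[X in (_ <= X)%N]muln1 -[X in (_ <= X * _)%N]card_ord.
apply: (@card_pair_le _ _ _ xpredT) => // x.
apply/card_le1_eqP => i j; rewrite !inE !subr_eq0 /= => /eqP hi /eqP hj.
have : ent r.1.1 * ent i = ent r.1.1 * ent j by rewrite hi hj.
have e0 : ent r.1.1 != 0 by rewrite gt_eqF ?ent_gt0.
by move/(mulfI e0) => [] /val_inj.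
Qed.

(** The first two entries of [s] fix [minor12 r s], which is nonzero and less than [N ^ 2] in size,
    so at most one prime above [N] divides it. That prime determines the third entry modulo itself,
    hence exactly. This replaces a union bound over infinitely many primes. *)
Lemma card_large_prime r : head_coprime r ->
  (#|[pred s | (minor12 r s != 0%R) &&
     `[< exists p, [/\ prime p, (N < p)%N & dependent_mod p r s] >] ]| <= N * N)%N.
Proof.
move=> cr; rewrite -[X in (_ <= X * _)%N]card_ord -[X in (_ <= _ * X)%N]card_ord.
rewrite -card_prod -[X in (_ <= X)%N]muln1.
apply: (@card_pair_le _ _ _ xpredT) => // u.
apply/card_le1_eqP => i j; rewrite !inE.
move=> /andP[m0 /asboolP[p [pp Np /dependent_modP[p12 p13 p23]]]].
move=> /andP[_ /asboolP[p' [pp' Np' /dependent_modP[p12' p13' p23']]]].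
have epp : p = p'.
  apply/eqP; apply: contraT => npp.
  have : (p * p' %| `|minor12 r (u, i)|)%N.
    rewrite Gauss_dvd; last by rewrite prime_coprime// dvdn_prime2.
    by rewrite (p12 : is_true (p %| _)%N) (p12' : is_true (p' %| _)%N).
  move=> /dvdn_leq; rewrite absz_gt0 m0 => /(_ isT) le.
  have := minor12_lt r (u, i); rewrite -abszE ltz_nat.
  by move/(leq_ltn_trans le); rewrite ltnNge -mulnn leq_mul// ltnW.
rewrite -epp in p12' p13' p23'.
have pr : ~~ ((p%:Z %| ent r.1.1)%Z && (p%:Z %| ent r.1.2)%Z).
  apply/negP => /andP[h1 h2].
  have : (p%:Z %| gcdz (ent r.1.1) (ent r.1.2))%Z by rewrite dvdz_gcd h1.
  by rewrite (eqP cr) dvdz1 /= => /eqP p1; rewrite p1 in pp.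
have : (p%:Z %| i%:Z - j%:Z)%Z.
  move: pr; rewrite negb_and => /orP[] pr.
    exact: dvd_solution pp pr p13 p13'.
  exact: dvd_solution pp pr p23 p23'.
move=> h; apply/val_inj => /=.
have : (p %| `|i%:Z - j%:Z|)%N by [].
have [//|ij] := eqVneq (i : nat) (j : nat).
move/dvdn_leq; rewrite absz_gt0 subr_eq0 eqz_nat ij => /(_ isT).
by move: (nat_of_ord i) (nat_of_ord j) (ltn_ord i) (ltn_ord j) Np; clear; lia.
Qed.

Variable R : realType.

Lemma card_head_coprime : (256 <= N)%N ->
  (N%:R ^+ 3) / 8 <= #|[pred r | head_coprime r]|%:R :> R.
Proof.
move=> N256.
pose C (u : I * I) := coprimez (ent u.1) (ent u.2).
pose D p := [pred i : I | (p%:Z %| ent i)%Z].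
have cD p : prime p -> (#|D p| <= (N %/ p).+1)%N.
  move=> pp; apply: (card_congr_le (f := id)) => //; first exact: prime_gt0.
  by move=> i j hi hj; rewrite -ent_sub_dvd rpredB.
have bad : #|predC C|%:R <= 7 / 8 * N%:R ^+ 2 :> R.
  apply: le_trans (sum_sqr_quotient_le R N256).
  apply: (@le_trans _ _ (\sum_(2 <= p < N.+1)
     #|[pred u : I * I | [&& prime p, D p u.1 & D p u.2]]|)%:R).
    rewrite ler_nat; apply: union_bound => -[x y] /= nC.
    pose p := pdiv (gcdn x.+1 y.+1).
    have g1 : (1 < gcdn x.+1 y.+1)%N.
      by rewrite ltn_neqAle gcdn_gt0 andbT eq_sym; exact: nC.
    have pg := pdiv_dvd (gcdn x.+1 y.+1); have pp := pdiv_prime g1.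
    exists p; split; first exact: prime_gt1.
      apply: leq_trans (ltn_ord x).
      by apply: dvdn_leq => //; apply: dvdn_trans pg (dvdn_gcdl _ _).
    by rewrite /= pp /= !dvdzE /= (dvdn_trans pg (dvdn_gcdl _ _)) (dvdn_trans pg (dvdn_gcdr _ _)).
  rewrite natr_sum; apply: ler_sum => p _; rewrite -natrX ler_nat.
  have [pp|pp] := boolP (prime p); last first.
    by rewrite (eq_card0 (A := [pred u : I * I | _]))// => u; rewrite !inE (negPf pp).
  apply: (@leq_trans (#|D p| * (N %/ p).+1)%N); last by rewrite -mulnn leq_mul2r cD.
  apply: card_pair_le; first by move=> x y /and3P[_ h _]; exact: h.
  move=> x.
  apply: leq_trans (cD p pp); apply/fintype.subset_leq_card/fintype.subsetP => y.
  by rewrite !inE => /and3P[].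
have cC : #|C|%:R >= N%:R ^+ 2 / 8 :> R.
  have := cardC C; rewrite card_prod card_ord => /(congr1 (fun k => k%:R : R)).
  rewrite natrD natrM; lra.
have -> : #|[pred r | head_coprime r]| = (#|C| * N)%N.
  rewrite -[X in (_ * X)%N]card_ord -cardX; apply: eq_card => -[u z].
  by rewrite !inE andbT.
rewrite natrM exprSr; have : 0 <= N%:R :> R by []; nra.
Qed.

(** Failures come from a zero minor or a prime above [N], at most [N ^ 2] rows each, and from primes
    up to [N], at most [7 / 8] of all rows; what is left exceeds [1 / 16]. *)
Lemma card_primitive_pair r : (256 <= N)%N -> head_coprime r ->
  (N%:R ^+ 3) / 16 <= #|[pred s | primitive_pair r s]|%:R :> R.
Proof.
move=> N256 cr.
pose Z := [pred s | minor12 r s == 0].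
pose L := [pred s | (minor12 r s != 0%R) &&
     `[< exists p, [/\ prime p, (N < p)%N & dependent_mod p r s] >] ].
pose P p := [pred s | prime p && dependent_mod p r s].
pose G := [pred s | primitive_pair r s].
pose U := [pred s | [exists p : 'I_N.+1, (1 < p)%N && P p s]].
have rnp p : prime p -> ~~ ((p%:Z %| ent r.1.1)%Z && (p%:Z %| ent r.1.2)%Z).
  move=> pp; apply/negP => /andP[h1 h2].
  have : (p%:Z %| gcdz (ent r.1.1) (ent r.1.2))%Z by rewrite dvdz_gcd h1.
  by rewrite (eqP cr) dvdz1 /= => /eqP p1; rewrite p1 in pp.
have cU : #|U|%:R <= N%:R * (7 / 8 * N%:R ^+ 2) :> R.
  apply: le_trans (ler_wpM2l _ (sum_sqr_quotient_le R N256)) => //.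
  apply: (@le_trans _ _ (\sum_(2 <= p < N.+1) #|P p|)%:R).
    rewrite ler_nat; apply: union_bound => s /existsP[p /andP[p1 Ps]].
    by exists p; rewrite p1 -ltnS ltn_ord.
  rewrite natr_sum mulr_sumr; apply: ler_sum => p _; rewrite -natrX -natrM ler_nat.
  have [pp|pp] := boolP (prime p); last first.
    by rewrite (eq_card0 (A := P p))// => u; rewrite !inE (negPf pp).
  apply: (@leq_trans #|[pred s | dependent_mod p r s]|).
    by apply/fintype.subset_leq_card/fintype.subsetP => s; rewrite !inE => /andP[].
  by rewrite -mulnn mulnA card_dependent_mod// rnp.
have cover : (#|{: row}| <= #|G| + (#|Z| + (#|L| + #|U|)))%N.
  have h (A B : pred row) : (#|predU A B| <= #|A| + #|B|)%N.
    by rewrite -cardUI leq_addr.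
  apply: leq_trans (leq_add (leqnn _) (leq_add (leqnn _) (h _ _))).
  apply: leq_trans (leq_add (leqnn _) (h _ _)).
  apply: leq_trans (h _ _).
  apply/fintype.subset_leq_card/fintype.subsetP => s _; rewrite !inE /primitive_pair.
  have [_|m0] := eqVneq (minor12 r s) 0; first by rewrite orbT.
  rewrite /=; case: eqP => //= g1; apply/orP.
  pose g := gcdz (minor12 r s) (gcdz (minor13 r s) (minor23 r s)).
  have g0 : g != 0 by rewrite /g gcdz_eq0 (negPf m0).
  have gg1 : (1 < `|g|)%N.
    have : `|g|%N != 1%N by apply/eqP => e; apply: g1; rewrite /gcdz; congr Posz.
    by move: g0; rewrite -absz_gt0; case: (`|g|%N) => [|[]].
  have pp := pdiv_prime gg1; set p := pdiv _ in pp.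
  have pg : (p%:Z %| g)%Z by rewrite dvdzE /= pdiv_dvd.
  have dep : dependent_mod p r s.
    by apply/dependent_modP; move: pg; rewrite /g !dvdz_gcd => /andP[h1 /andP[h2 h3]].
  have [pN|Np] := leqP p N; [right|left; apply/asboolP; by exists p].
  apply/existsP; exists (Ordinal (pN : (p < N.+1)%N)).
  by rewrite /= pp dep prime_gt1.
have cZ := card_zero_minor r; have cL := card_large_prime cr.
have : (N * N * N <= #|G| + (N * N + N * N) + #|U|)%N.
  apply: leq_trans (_ : _ <= #|{: row}|)%N _; first by rewrite !card_prod !card_ord.
  apply: leq_trans cover _; rewrite -addnA leq_add2l addnA leq_add2r; exact: leq_add.
rewrite -(ler_nat R) !natrD !natrM => H.
have N256R : 256 <= N%:R :> R by rewrite ler_nat.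
rewrite -/G; nra.
Qed.

Lemma card_admissible : (256 <= N)%N ->
  (N%:R ^+ 6) / 128 <= #|[pred u : row * row | head_coprime u.1 && primitive_pair u.1 u.2]|%:R :> R.
Proof.
move=> N256.
have -> : #|[pred u : row * row | head_coprime u.1 && primitive_pair u.1 u.2]|%:R =
   \sum_(r | head_coprime r) #|[pred s | primitive_pair r s]|%:R :> R.
  rewrite -sum1_card -natr_sum; congr _%:R.
  under [RHS]eq_bigr do rewrite -sum1_card.
  by rewrite pair_big_dep; apply: eq_bigl => -[].
apply: (@le_trans _ _ (\sum_(r | head_coprime r) (N%:R ^+ 3) / 16)); last first.
  by apply: ler_sum => r cr; apply: card_primitive_pair.
rewrite sumr_const -(mulr_natl (N%:R ^+ 3 / 16)).
have c0 : 0 <= N%:R ^+ 3 / 16 :> R by rewrite divr_ge0 ?exprn_ge0.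
have -> : N%:R ^+ 6 / 128 = N%:R ^+ 3 / 8 * (N%:R ^+ 3 / 16) :> R by field.
by have := ler_wpM2r c0 (card_head_coprime N256); apply.
Qed.

End Rows.

(** * Completion to a unimodular matrix *)

(* Reduces the third row of an integral basis modulo the first two. *)
Lemma reduce_row (x1 y1 z1 x2 y2 z2 w0 w1 w2 n : int) :
  let l := x1 * y2 - x2 * y1 in l != 0 ->
  0 < x1 <= n -> 0 < y1 <= n -> 0 < z1 <= n ->
  0 < x2 <= n -> 0 < y2 <= n -> 0 < z2 <= n ->
  w0 * (y1 * z2 - y2 * z1) - w1 * (x1 * z2 - x2 * z1) + w2 * l = 1 ->
  exists t0 t1 t2,
    [/\ t0 * (y1 * z2 - y2 * z1) - t1 * (x1 * z2 - x2 * z1) + t2 * l = 1,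
        `|t0| <= 3 * n, `|t1| <= 3 * n & `|t2| <= 3 * n].
Proof.
move=> l l0 hx1 hy1 hz1 hx2 hy2 hz2 hw.
have n1 : 1 <= n by case/andP: hx1 => x0 xn; apply: le_trans xn; rewrite gtz0_ge1 in x0.
have ln : 0 < `|l| by rewrite normr_gt0.
(* By Cramer's rule [a / l] and [b / l] are the coordinates of [(w0, w1)] in the basis formed by the
   first two entries of the given rows; removing their integral parts leaves coordinates in [[0, 1)]
   up to sign. *)
pose a := w0 * y2 - x2 * w1; pose b := x1 * w1 - y1 * w0.
pose t0 := w0 - (a %/ l)%Z * x1 - (b %/ l)%Z * x2.
pose t1 := w1 - (a %/ l)%Z * y1 - (b %/ l)%Z * y2.
pose t2 := w2 - (a %/ l)%Z * z1 - (b %/ l)%Z * z2.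
have ea := divz_eq a l; have eb := divz_eq b l.
have a0 : 0 <= (a %% l)%Z < `|l| by rewrite modz_ge0// ltz_mod.
have b0 : 0 <= (b %% l)%Z < `|l| by rewrite modz_ge0// ltz_mod.
have e0 : l * t0 = (a %% l)%Z * x1 + (b %% l)%Z * x2.
  have -> : (a %% l)%Z = a - (a %/ l)%Z * l by rewrite {2}ea; ring.
  have -> : (b %% l)%Z = b - (b %/ l)%Z * l by rewrite {2}eb; ring.
  rewrite /t0 /a /b /l; ring.
have e1 : l * t1 = (a %% l)%Z * y1 + (b %% l)%Z * y2.
  have -> : (a %% l)%Z = a - (a %/ l)%Z * l by rewrite {2}ea; ring.
  have -> : (b %% l)%Z = b - (b %/ l)%Z * l by rewrite {2}eb; ring.
  rewrite /t1 /a /b /l; ring.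
have ht : t0 * (y1 * z2 - y2 * z1) - t1 * (x1 * z2 - x2 * z1) + t2 * l = 1.
  by rewrite -hw /t0 /t1 /t2 /l; ring.
(* The third entry is forced by the determinant; the extra 1 is the reason for [3 * n] instead of
   [2 * n]. *)
have e2 : l * t2 = (a %% l)%Z * z1 + (b %% l)%Z * z2 + 1.
  apply: (mulfI l0); rewrite -[in RHS]ht.
  have -> : l * ((a %% l)%Z * z1 + (b %% l)%Z * z2 +
    (t0 * (y1 * z2 - y2 * z1) - t1 * (x1 * z2 - x2 * z1) + t2 * l)) =
    l * (a %% l)%Z * z1 + l * (b %% l)%Z * z2 + (l * t0) * (y1 * z2 - y2 * z1)
     - (l * t1) * (x1 * z2 - x2 * z1) + l * (l * t2) by ring.
  rewrite e0 e1 /l; ring.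
have comb (c d u v : int) : 0 <= c < `|l| -> 0 <= d < `|l| ->
    0 < u <= n -> 0 < v <= n -> 0 <= c * u + d * v <= `|l| * (2 * n).
  move=> /andP[c0 cl] /andP[d0 dl] /andP[u0 un] /andP[v0 vn].
  have p1 : c * u <= `|l| * n by rewrite ler_pM// ltW.
  have p2 : d * v <= `|l| * n by rewrite ler_pM// ltW.
  have q1 : 0 <= c * u by rewrite mulr_ge0// ltW.
  have q2 : 0 <= d * v by rewrite mulr_ge0// ltW.
  by apply/andP; split; lra.
have bound (t m : int) : 0 <= m <= `|l| * (2 * n) -> l * t = m -> `|t| <= 3 * n.
  move=> /andP[m0 mn] e; rewrite -(ler_pM2l ln) -normrM e ger0_norm//.
  by apply: le_trans mn _; rewrite ler_pM2l//; lra.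
exists t0, t1, t2; split=> //.
- exact: bound (comb _ _ _ _ a0 b0 hx1 hx2) e0.
- exact: bound (comb _ _ _ _ a0 b0 hy1 hy2) e1.
- have /andP[m0 mn] := comb _ _ _ _ a0 b0 hz1 hz2.
  rewrite -(ler_pM2l ln) -normrM e2 ger0_norm; last by rewrite addr_ge0.
  have : `|l| * 1 <= `|l| * n by rewrite ler_pM2l.
  by rewrite gtz0_ge1 in ln; lra.
Qed.

Section Completion.
Variable N : nat.
Local Notation I := 'I_N.
Local Notation row := (I * I * I)%type.
Implicit Types (r s : row) (k : 'I_3).

Definition entry r k : I :=
  match val k with 0%N => r.1.1 | 1%N => r.1.2 | _ => r.2 end.

Definition mx_rows (x y z : 'I_3 -> int) : 'M[int]_3 :=
  \matrix_(i, j) match val i with 0%N => x j | 1%N => y j | _ => z j end.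

Lemma complete_rows r s : primitive_pair r s -> exists g : SL3Z,
  [/\ forall k, val g 0 k = ent (entry r k), forall k, val g 1 k = ent (entry s k)
    & forall i k, `|val g i k| <= 3 * N%:Z].
Proof.
move=> /andP[l0 /eqP g1].
have [x [y exy]] := Bezoutz (minor12 r s) (gcdz (minor13 r s) (minor23 r s)).
have [u [v euv]] := Bezoutz (minor13 r s) (minor23 r s).
have en i : 0 < ent (i : I) <= N%:Z by rewrite ent_gt0 ent_le.
have [|t0 [t1 [t2 [ht h0 h1 h2]]]] := @reduce_row _ _ (ent r.2) _ _ (ent s.2)
  (y * v) (- (y * u)) x N%:Z l0 (en _) (en _) (en _) (en _) (en _) (en _).
  rewrite -/(minor12 r s) -/(minor13 r s) -/(minor23 r s) -g1 -exy -euv; ring.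
pose t (k : 'I_3) : int := match val k with 0%N => t0 | 1%N => t1 | _ => t2 end.
pose g := mx_rows (fun k => ent (entry r k)) (fun k => ent (entry s k)) t.
have dg : \det g == 1.
  by rewrite -[X in _ == X]ht det_mx33 !mxE /entry /t /=; apply/eqP; ring.
exists (exist _ g dg); split=> [k|k|i k]; rewrite /= ?mxE //=.
have ent3 j : `|ent (j : I)| <= 3 * N%:Z.
  have /andP[j0 jN] := en j; rewrite gtr0_norm//; lra.
case: (I3P i) => -> //=.
by case: (I3P k) => ->.
Qed.

End Completion.

(** * Rigidity of small entries modulo q *)

Section FieldReduction.
Variables (F : finFieldType) (q N : nat).
Hypothesis intF : forall m : int, (m%:~R == 0 :> F) = (q%:Z %| m)%Z.
Hypothesis N2q : (2 * N ^ 2 < q)%N.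
Local Notation I := 'I_N.
Local Notation row := (I * I * I)%type.
Implicit Types (r s : row) (k : 'I_3).

Lemma intF_small (m : int) : m%:~R = 0 :> F -> `|m| < q%:Z -> m = 0.
Proof.
move/eqP; rewrite intF dvdzE -abszE ltz_nat /= => qm mq.
by apply/eqP; rewrite -absz_eq0; apply: contraLR mq; rewrite -lt0n -leqNgt => /dvdn_leq ->.
Qed.

Local Notation fent i := ((ent i)%:~R : F).

Lemma ent_cross (a : F) (i i' j j' : I) : fent i' = a * fent i -> fent j' = a * fent j ->
  ent i' * ent j = ent i * ent j'.
Proof.
move=> hi hj; apply/eqP; rewrite -subr_eq0; apply/eqP/intF_small.
  by rewrite rmorphB !rmorphM /= hi hj; ring.
have en (k k' : I) : 0 < ent k * ent k' <= N%:Z * N%:Z.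
  by rewrite mulr_gt0 ?ent_gt0// ler_pM ?ent_le// ltW ?ent_gt0.
have /andP[] := en i' j; have /andP[] := en i j'.
have : (2 * (N%:Z * N%:Z) < q%:Z)%R by rewrite -!PoszM ltz_nat mulnn.
by rewrite ltr_norml; lia.
Qed.

(** Since [2 * N ^ 2 < q], proportionality modulo [q] gives equal integer cross products. Coprime
    positive heads that are proportional over the rationals coincide, and the remaining entries
    follow. *)
Lemma proportional_eq r s r' s' (a : F) : head_coprime r -> head_coprime r' ->
  (forall k, fent (entry r' k) = a * fent (entry r k)) ->
  (forall k, fent (entry s' k) = a * fent (entry s k)) -> (r', s') = (r, s).
Proof.
move=> cr cr' hr hs.
have e11 : ent r'.1.1 = ent r.1.1.
  have e := ent_cross (hr 0) (hr 1); rewrite /entry /= in e.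
  have d1 : (ent r.1.1 %| ent r'.1.1)%Z.
    by rewrite -(@Gauss_dvdzl _ _ (ent r.1.2))// e dvdz_mulr.
  have d2 : (ent r'.1.1 %| ent r.1.1)%Z.
    by rewrite -(@Gauss_dvdzl _ _ (ent r'.1.2))// -e dvdz_mulr.
  by move: d1 d2; rewrite !dvdzE /= => d1 d2; congr Posz; apply/eqP; rewrite eqn_dvd d1 d2.
have key (j j' : I) : fent j' = a * fent j -> j' = j.
  move/(ent_cross (hr 0)); rewrite /entry /= e11.
  have e0 : ent r.1.1 != 0 by rewrite gt_eqF ?ent_gt0.
  by move/(mulfI e0) => [] /val_inj.
have eqrow (u u' : row) : (forall k, fent (entry u' k) = a * fent (entry u k)) -> u' = u.
  move=> h; case: u u' h => [[x y] z] [[x' y'] z'] h.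
  have := key _ _ (h 0); have := key _ _ (h 1); have := key _ _ (h 2).
  by rewrite /entry /= => -> -> ->.
by rewrite (eqrow _ _ hr) (eqrow _ _ hs).
Qed.

End FieldReduction.

(** * Pairs of row pairs with a common dependency modulo q *)

Lemma card_exists_le (T J : finType) (P : J -> pred T) :
  (#|[pred x | [exists j, P j x]]| <= \sum_j #|P j|)%N.
Proof.
have -> : (\sum_j #|P j| = \sum_j \sum_x if P j x then 1 else 0)%N.
  by apply: eq_bigr => j _; rewrite -sum1_card big_mkcond.
rewrite -sum1_card big_mkcond exchange_big; apply: leq_sum => x _ /=.
case: ifPn => // /existsP[j Pj]; by rewrite (bigD1 j)//= Pj.
Qed.

Lemma card_pair_sum (A B : finType) (S : pred (A * B)) :
  (#|S| = \sum_a #|[pred b | S (a, b)]|)%N.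
Proof.
transitivity (\sum_a \sum_b if S (a, b) then 1 else 0)%N.
  by rewrite pair_bigA /= -sum1_card big_mkcond; apply: eq_bigr => -[a b].
by apply: eq_bigr => a _; rewrite -sum1_card [RHS]big_mkcond.
Qed.

Section DependentPairs.
Variables (R : realType) (F : finFieldType) (q N : nat).
Hypothesis intF : forall m : int, (m%:~R == 0 :> F) = (q%:Z %| m)%Z.
Hypothesis cardF : #|F| = q.
Hypothesis N2q : (2 * N ^ 2 < q)%N.
Local Notation I := 'I_N.
Local Notation row := (I * I * I)%type.
Local Notation fent i := ((ent i)%:~R : F).

(* [o] encodes a point of the projective line: [Some mu] is [1 : mu] and
   [None] is [0 : 1]. *)
Definition lin (o : option F) (c : I * I) : F :=
  if o is Some mu then fent c.1 + mu * fent c.2 else fent c.2.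

Definition level o z := #|[pred c | lin o c == z]|.
Definition max_level o := \max_c level o (lin o c).

Let cardII : #|{: I * I}| = (N ^ 2)%N.
Proof. by rewrite card_prod card_ord mulnn. Qed.

Lemma level_le_max o z : (level o z <= max_level o)%N.
Proof.
case: (pickP [pred c | lin o c == z]) => [c /eqP <-|h].
  exact: (leq_bigmax (F := fun c => level o (lin o c))).
by rewrite /level (eq_card0 h).
Qed.

Definition relations (o : option F) (a : F) :=
  #|[pred w : (I * I) * (I * I) | lin o w.2 == a * lin o w.1]|.

Lemma relations_le_max o a : (relations o a <= N ^ 2 * max_level o)%N.
Proof.
rewrite /relations card_pair_sum -cardII -sum_nat_const.
by apply: leq_sum => c _; exact: (level_le_max o (a * lin o c)).
Qed.

Let fent_inj : injective (fun i : I => fent i).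
Proof.
move=> i j e; apply/val_inj.
have : ent i = ent j; last by case.
apply/eqP; rewrite -subr_eq0; apply/eqP/(intF_small intF).
  by rewrite rmorphB /= e subrr.
have := ent_gt0 i; have := ent_gt0 j; have := ent_le i; have := ent_le j.
have : (N%:Z < q%:Z)%R.
  rewrite ltz_nat (leq_ltn_trans _ N2q)//; clear; nia.
by rewrite ltr_norml; lia.
Qed.

Let fent_neq0 (i : I) : fent i != 0.
Proof.
apply/eqP => /(intF_small intF); rewrite gtr0_norm ?ent_gt0// => h.
suff /h : ent i < q%:Z by have := ent_gt0 i; lra.
apply: le_lt_trans (ent_le i) _; rewrite ltz_nat (leq_ltn_trans _ N2q)//; clear; nia.
Qed.

Lemma level_none z : (level None z <= N)%N.
Proof.
rewrite -[leqRHS]muln1 -[X in (_ <= X * _)%N]card_ord.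
apply: (@card_pair_le _ _ _ xpredT) => // x.
by apply/card_le1_eqP => i j; rewrite !inE => /eqP <- /eqP /fent_inj.
Qed.

Lemma level_zero o : (level o 0%R <= N)%N.
Proof.
case: o => [mu|]; last exact: level_none.
rewrite -[leqRHS]muln1 -[X in (_ <= X * _)%N]card_ord.
apply: card_swap_le => y.
apply/card_le1_eqP => i j; rewrite !inE /= => /eqP + /eqP e; rewrite -[in RHS]e.
by move/addIr/fent_inj.
Qed.

(** For [lin o c] nonzero, distinct [a] give distinct values, so the levels involved add up to at
    most [N ^ 2]. The at most [N] pairs [c] in the kernel are counted trivially. *)
Lemma sum_relations o :
  (\sum_(a : F | a != 0%R) relations o a <= N ^ 2 * N ^ 2 + N * (q * N))%N.
Proof.
have -> : (\sum_(a : F | a != 0%R) relations o a =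
   \sum_c \sum_(a : F | a != 0%R) level o (a * lin o c)%R)%N.
  by rewrite exchange_big; apply: eq_bigr => a _; apply: card_pair_sum.
have tot : (\sum_z level o z = N ^ 2)%N.
  rewrite -cardII -sum1_card.
  rewrite (partition_big (lin o) xpredT)//=; apply: eq_bigr => z _.
  by rewrite /level -sum1_card; apply: eq_bigl => c.
rewrite (bigID (fun c => lin o c == 0)) /= addnC; apply: leq_add.
  apply: (@leq_trans (\sum_(c : I * I | lin o c != 0%R) N ^ 2)%N).
    apply: leq_sum => c c0; rewrite -tot.
    have mI : injective (fun a : F => a * lin o c) by move=> a b /(mulIf c0).
    rewrite [leqRHS](reindex_inj mI) /= [leqLHS]big_mkcond.
    by apply: leq_sum => a _; case: ifP.
  rewrite sum_nat_const leq_mul2r; apply/orP; right.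
  by rewrite -cardII; apply: max_card.
apply: (@leq_trans (\sum_(c : I * I | lin o c == 0%R) q * N)%N).
  apply: leq_sum => c /eqP ->; under eq_bigr do rewrite mulr0.
  rewrite sum_nat_const leq_mul ?level_zero// -cardF; exact: max_card.
by rewrite sum_nat_const leq_mul2r (level_zero o) orbT.
Qed.

(** The index encodes a vector [(d, e)] by [e - 1], [|d|] and the sign of [d]; the weight is the
    product of the bounds [2 * N / e] and [2 * N / max(1, |d|)] for the size of a level. *)
Let weight (t : I * 'I_N.+1 * bool) : R :=
  4 * N%:R ^+ 2 / ((t.1.1).+1%:R * (maxn 1 t.1.2)%:R).

Let related (mu : F) (t : I * 'I_N.+1 * bool) :=
  (-1) ^+ t.2 * (t.1.2 : nat)%:R + mu * fent t.1.1 == 0.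

Let weight_ge0 t : 0 <= weight t.
Proof. by rewrite divr_ge0 ?mulr_ge0 ?exprn_ge0. Qed.

(* Differences of points on one level set of [lin (Some mu)] lie in a lattice
   whose short vectors are all multiples of one of them, [(d, e)]; so the
   level has at most [N / e + 1] and [N / |d| + 1] points. *)
Lemma max_level_sqr mu : (max_level (Some mu))%:R ^+ 2 <=
  1 + \sum_(t | related mu t) weight t.
Proof.
have sum0 : 0 <= \sum_(t | related mu t) weight t by apply: sumr_ge0.
have [m1|m1] := leqP (max_level (Some mu)) 1.
  apply: (@le_trans _ _ 1); last by rewrite lerDl.
  by rewrite expr_le1// lern1.
have [c /card_gt1P[u [v [lu lv uv]]]] : exists c, (1 < level (Some mu) (lin (Some mu) c))%N.
  apply/existsP; apply: contraTT m1; rewrite negb_exists => /forallP h.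
  by rewrite -leqNgt; apply/bigmax_leqP => c _; rewrite leqNgt h.
pose P e := [exists d : 'I_N.+1, [exists b : bool,
   (0 < e)%N && ((-1) ^+ b * (d : nat)%:R + mu * e%:R == 0 :> F)]].
have short (d e : int) : `|d| <= N%:Z -> 0 < e -> d%:~R + mu * e%:~R = 0 -> P `|e|%N.
  move=> dN e0 h; have dlt : (`|d| < N.+1)%N by rewrite ltnS -lez_nat abszE.
  apply/existsP; exists (Ordinal dlt); apply/existsP; exists (d < 0).
  rewrite absz_gt0 gt_eqF//= -[X in _ == X]h; apply/eqP; congr (_ + mu * _); last first.
    by rewrite -[in RHS](gtz0_abs e0).
  by rewrite [in RHS](intEsign d) rmorphM rmorph_sign.
have diff_le (i j : I) : `|ent i - ent j| <= N%:Z.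
  have := ent_gt0 i; have := ent_gt0 j; have := ent_le i; have := ent_le j.
  by rewrite ler_norml; lra.
have rel (w w' : I * I) : lin (Some mu) w = lin (Some mu) w' ->
    (ent w.1 - ent w'.1)%:~R + mu * (ent w.2 - ent w'.2)%:~R = 0 :> F.
  move=> /eqP; rewrite -subr_eq0 => /eqP <-; rewrite !rmorphB /=; ring.
have small (d : int) : d%:~R = 0 :> F -> `|d| <= N%:Z -> d = 0.
  move=> h dN; apply: (intF_small intF h); apply: le_lt_trans dN _.
  by rewrite ltz_nat (leq_ltn_trans _ N2q)//; clear; nia.
have inj2 w w' : lin (Some mu) w = lin (Some mu) w' -> w.2 = w'.2 -> w = w'.
  move=> /rel + e2; rewrite e2 subrr mulr0 addr0 => /small/(_ (diff_le _ _))/eqP.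
  rewrite subr_eq0 => /eqP[] /val_inj; case: w w' e2 => [? ?] [? ?] /= -> -> //.
have exP : exists e, P e && (e <= N)%N.
  move: lu lv; rewrite !inE => /eqP lu /eqP lv; rewrite -lv in lu.
  have /eqP e0 : ent u.2 - ent v.2 != 0.
    apply: contra_neq uv; move/eqP; rewrite subr_eq0 => /eqP[] /val_inj.
    exact: inj2.
  exists `|ent u.2 - ent v.2|%N; rewrite -lez_nat abszE diff_le andbT.
  have [ep|en|//] := ltrgt0P (ent u.2 - ent v.2).
    exact: short (diff_le _ _) ep (rel _ _ lu).
  rewrite -abszN opprB; apply: short (diff_le _ _) _ (rel _ _ (esym lu)).
  by rewrite subr_gt0 -subr_lt0.
(* The generating vector [(d, e0)] is chosen with the least positive second coordinate among lattice
   vectors with first coordinate at most [N] in size. *)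
case: (ex_minnP exP) => e0 /andP[/existsP[d0 /existsP[b /andP[e0_gt0 /eqP r0]]] e0N] emin.
have N0 : (0 < N)%N by apply: leq_trans e0_gt0 e0N.
pose d : int := (-1) ^+ b * (d0 : nat)%:Z.
have dabs : `|d|%N = d0 by rewrite /d abszMsign.
have dN : `|d| <= N%:Z by rewrite -abszE dabs lez_nat -ltnS ltn_ord.
have rd : d%:~R + mu * e0%:Z%:~R = 0 :> F by rewrite -[RHS]r0 /d rmorphM rmorph_sign.
clearbody d.
(* The determinant of two lattice vectors vanishes modulo [q], and here its size is at most
   [2 * N ^ 2 < q]. *)
have par w w' : lin (Some mu) w = lin (Some mu) w' ->
    (ent w.1 - ent w'.1) * e0%:Z = d * (ent w.2 - ent w'.2).
  move=> /rel; have := diff_le w.1 w'.1; have := diff_le w.2 w'.2.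
  set x := ent w.1 - _; set y := ent w.2 - _ => yN xN rxy.
  apply/eqP; rewrite -subr_eq0; apply/eqP/(intF_small intF).
    rewrite rmorphB !rmorphM /=.
    have -> : x%:~R = - (mu * y%:~R) by apply/eqP; rewrite -addr_eq0 rxy.
    have -> : d%:~R = - (mu * e0%:Z%:~R) by apply/eqP; rewrite -addr_eq0 rd.
    ring.
  have h1 : `|x * e0%:Z| <= N%:Z * N%:Z by rewrite normrM ler_pM.
  have h2 : `|d * y| <= N%:Z * N%:Z by rewrite normrM ler_pM.
  have h3 : (2 * (N%:Z * N%:Z) < q%:Z)%R by rewrite -!PoszM ltz_nat mulnn.
  by apply: le_lt_trans (ler_normB _ _) _; lra.
have e0z : e0%:Z != 0 by rewrite eqz_nat -lt0n.
(* Otherwise subtracting a multiple of [(d, e0)] leaves a parallel vector with smaller positive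
   second coordinate and first coordinate still within [N], against minimality. *)
have dvd w w' : lin (Some mu) w = lin (Some mu) w' -> (e0%:Z %| ent w.2 - ent w'.2)%Z.
  move=> ww; have := par _ _ ww; have := rel _ _ ww.
  set x := ent w.1 - _; set y := ent w.2 - _ => rxy pxy; clearbody x y.
  apply: contraT => ny.
  have r_gt0 : 0 < (y %% e0%:Z)%Z.
    by rewrite lt0r modz_ge0// andbT; apply: contra ny => /eqP/dvdz_mod0P.
  have rlt : (y %% e0%:Z)%Z < e0%:Z by rewrite ltz_pmod// ltz_nat.
  pose k := (y %/ e0%:Z)%Z.
  have yk : y = k * e0%:Z + (y %% e0%:Z)%Z := divz_eq y e0%:Z.
  clearbody k.
  have h : (x - k * d) * e0%:Z = d * (y %% e0%:Z)%Z.
    by rewrite mulrBl pxy {1}yk; ring.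
  have xN : `|x - k * d| <= N%:Z.
    apply: le_trans dN; rewrite -(ler_pM2r (_ : 0 < e0%:Z))// -{1}(ger0_norm (_ : 0 <= e0%:Z))//.
    by rewrite -normrM h normrM ler_wpM2l// gtr0_norm// ltW.
  have Pr : P `|(y %% e0%:Z)%Z|%N.
    apply: short xN r_gt0 _.
    have -> : (y %% e0%:Z)%Z = y - k * e0%:Z by rewrite {2}yk; ring.
    rewrite !rmorphB !rmorphM /=.
    transitivity (x%:~R + mu * y%:~R - k%:~R * (d%:~R + mu * e0%:Z%:~R)); first by ring.
    by rewrite rxy rd; ring.
  have rle : (`|(y %% e0%:Z)%Z| < e0)%N by rewrite -ltz_nat abszE gtr0_norm.
  by have := emin _ (introT andP (conj Pr (leq_trans (ltnW rle) e0N))); rewrite leqNgt rle.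
have lev1 : (max_level (Some mu) <= (N %/ e0).+1)%N.
  apply/bigmax_leqP => w _; apply: (card_congr_le (f := fun u => u.2)) => //.
    by move=> u1 u2; rewrite !inE => /eqP h1 /eqP h2; apply: inj2; rewrite h1 h2.
  by move=> u1 u2 /eqP h1 /eqP h2; rewrite -ent_sub_dvd; apply: dvd; rewrite h1 h2.
have lev2 : (max_level (Some mu) <= (N %/ maxn 1 d0).+1)%N.
  apply/bigmax_leqP => w _; have [dz|dz] := posnP (d0 : nat).
    apply: (card_congr_le (f := fun u => u.2)); first by rewrite leq_max.
      by move=> u1 u2; rewrite !inE => /eqP h1 /eqP h2; apply: inj2; rewrite h1 h2.
    by rewrite dz => *; rewrite dvd1z.
  have d0z : d != 0 by rewrite -absz_eq0 dabs -lt0n.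
  rewrite (maxn_idPr dz); apply: (card_congr_le (f := fun u => u.1)) => //.
    move=> u1 u2; rewrite !inE => /eqP h1 /eqP h2 e1.
    have u12 : lin (Some mu) u1 = lin (Some mu) u2 by rewrite h1 h2.
    apply: inj2 => //; have := par _ _ u12; rewrite e1 subrr mul0r => /esym/eqP.
    by rewrite mulf_eq0 (negPf d0z) subr_eq0 /= => /eqP[] /val_inj.
  move=> u1 u2 /eqP h1 /eqP h2; rewrite -ent_sub_dvd.
  have u12 : lin (Some mu) u1 = lin (Some mu) u2 by rewrite h1 h2.
  have /dvdzP[k ek] := dvd _ _ u12.
  have -> : ent u1.1 - ent u2.1 = k * d.
    by apply: (mulIf e0z); rewrite par// ek; ring.
  by rewrite -dabs dvdzE abszM dvdn_mull.
have quot (k : nat) : (0 < k)%N -> (k <= N)%N -> (N %/ k).+1%:R <= 2 * N%:R / k%:R :> R.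
  move=> k0 kN; rewrite ler_pdivlMr ?ltr0n// -!natrM ler_nat mulSn mul2n -addnn.
  by rewrite leq_add// leq_trunc_div.
have e0lt : (e0.-1 < N)%N by rewrite prednK.
pose t : I * 'I_N.+1 * bool := (Ordinal e0lt, d0, b).
have rt : related mu t by rewrite /related /t /ent /= prednK// r0.
apply: (@le_trans _ _ (weight t)); last first.
  rewrite (bigD1 t) //= addrCA lerDl addr_ge0// sumr_ge0//.
apply: (@le_trans _ _ ((N %/ e0).+1%:R * (N %/ maxn 1 d0).+1%:R)).
  by rewrite expr2 ler_pM// ler_nat.
have p0 : (0 < maxn 1 d0)%N by rewrite leq_max.
have pN : (maxn 1 d0 <= N)%N by rewrite geq_max N0 -ltnS ltn_ord.
apply: (@le_trans _ _ ((2 * N%:R / e0%:R) * (2 * N%:R / (maxn 1 d0)%:R))).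
  by rewrite ler_pM// quot.
rewrite /weight /t /= prednK// le_eqVlt; apply/orP; left; apply/eqP.
by field; rewrite !pnatr_eq0 -!lt0n e0_gt0 p0.
Qed.

Lemma sum_weight : \sum_t weight t =
  8 * N%:R ^+ 2 * (harmonic_sum R N * (1 + harmonic_sum R N)).
Proof.
have h1 : \sum_(e : I) (e.+1%:R)^-1 = harmonic_sum R N.
  by rewrite /harmonic_sum big_add1 /= big_mkord.
have h2 : \sum_(d : 'I_N.+1) (maxn 1 d)%:R^-1 = 1 + harmonic_sum R N.
  rewrite big_ord_recl /= invr1 -h1; congr (_ + _); apply: eq_bigr => i _.
  by rewrite (maxn_idPr _).
rewrite -h2 -{1}h1 big_distrlr /= pair_bigA /= mulr_sumr.
transitivity (\sum_(p : I * 'I_N.+1) \sum_(b : bool) weight (p, b)).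
  by rewrite pair_bigA; apply: eq_bigr => -[].
apply: eq_bigr => p _; rewrite big_bool /weight /= -mulr2n -mulr_natl.
by field; rewrite pnatr_eq0 /= addrC natr1 pnatr_eq0 -lt0n leq_max.
Qed.

Hypothesis qN : (q <= 8 * N ^ 2)%N.

Let N_gt0 : (0 < N)%N.
Proof. by case: N N2q qN => //; lia. Qed.

(** Each short vector is related to at most one [mu], so after exchanging the sums every weight is
    counted once. The constant is [25 = 1 + 8 + 16]. *)
Lemma sum_max_level_sqr : \sum_o (max_level o)%:R ^+ 2 <=
  25 * N%:R ^+ 2 * harmonic_sum R N ^+ 2.
Proof.
rewrite (bigD1 None) //= (reindex_onto Some (odflt 0)) /=; last by case.
under eq_bigl do rewrite eqxx.
have m0 : (max_level None)%:R ^+ 2 <= N%:R ^+ 2 :> R.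
  by rewrite ler_sqr ?nnegrE// ler_nat; apply/bigmax_leqP => c _; apply: level_none.
have m1 : \sum_mu (max_level (Some mu))%:R ^+ 2 <=
    q%:R + 8 * N%:R ^+ 2 * (harmonic_sum R N * (1 + harmonic_sum R N)).
  apply: le_trans (ler_sum _ (fun mu _ => max_level_sqr mu)) _.
  rewrite big_split /= sumr_const cardF lerD2l -sum_weight.
  rewrite (exchange_big_dep xpredT) //=; apply: ler_sum => t _.
  rewrite sumr_const -(mulr_natl (weight t)) ler_piMl// lern1.
  apply/card_le1_eqP => x y; rewrite !unfold_in /related => /eqP hx /eqP.
  by rewrite -[in RHS]hx => /addrI /(mulIf (fent_neq0 _)).
have h1 := @harmonic_sum_ge1 R _ N_gt0.
have qR : q%:R <= 8 * N%:R ^+ 2 :> R by rewrite -natrX -natrM ler_nat.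
apply: le_trans (lerD m0 m1) _.
set x := N%:R ^+ 2 in qR *; set h := harmonic_sum R N in h1 *.
have x0 : 0 <= x by rewrite sqr_ge0.
have hh : 1 <= h ^+ 2 by nra.
have e1 : x <= x * h ^+ 2 by rewrite ler_peMr.
have e2 : x * h <= x * h ^+ 2 by rewrite ler_wpM2l//; nra.
nra.
Qed.

Definition pair_lin o (u : row * row) (k : 'I_3) : F :=
  lin o (entry u.1 k, entry u.2 k).

(* Necessary for completions [g], [g'] of [w.1], [w.2] to satisfy
   rank (g' - a g) <= 1 modulo [q] for some [a]. *)
Definition dependent_pairs (w : (row * row) * (row * row)) :=
  [exists p : option F * F, (p.2 != 0) &&
    [forall k, pair_lin p.1 w.2 k == p.2 * pair_lin p.1 w.1 k]].

(** For fixed [o] and [a] the three columns are independent, giving [relations o a ^ 3]. Two factors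
    are bounded by the largest level, the third is summed over [a]; the constants are
    [9 * 25 = 225]. *)
Lemma card_dependent_pairs :
  #|[pred w | dependent_pairs w]|%:R <=
  225 * N%:R ^+ 10 * harmonic_sum R N ^+ 2 :> R.
Proof.
pose P (p : option F * F) := [pred w : (row * row) * (row * row) | (p.2 != 0) &&
    [forall k, pair_lin p.1 w.2 k == p.2 * pair_lin p.1 w.1 k]].
have cP o a : (#|P (o, a)| <= if a != 0%R then relations o a ^ 3 else 0)%N.
  case: ifPn => [a0|a0]; last first.
    by rewrite leqn0; apply/eqP/eq_card0 => w; rewrite !inE /= (negPf a0).
  pose Q := [pred w : (I * I) * (I * I) | lin o w.2 == a * lin o w.1].
  have -> : (relations o a ^ 3 = #|(ffun_on Q : pred {ffun 'I_3 -> (I * I) * (I * I)})|)%N.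
    by rewrite card_ffun_on card_ord.
  pose g (w : (row * row) * (row * row)) : {ffun 'I_3 -> (I * I) * (I * I)} :=
    [ffun k => ((entry w.1.1 k, entry w.1.2 k), (entry w.2.1 k, entry w.2.2 k))].
  have gI : injective g.
    move=> [[r s] [r' s']] [[t u] [t' u']] /ffunP e.
    have := e 0; have := e 1; have := e 2; rewrite !ffunE /entry /=.
    move: r s r' s' t u t' u' {e} => [[? ?] ?] [[? ?] ?] [[? ?] ?] [[? ?] ?].
    by move=> [[? ?] ?] [[? ?] ?] [[? ?] ?] [[? ?] ?] /= [-> -> -> ->] [-> -> -> ->] [-> -> -> ->].
  rewrite -(fintype.card_image gI); apply/fintype.subset_leq_card/fintype.subsetP.
  move=> _ /fintype.imageP[w /andP[_ /forallP wP] ->].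
  by apply/ffun_onP => k; rewrite ffunE inE; apply: wP.
have c1 : (#|[pred w | dependent_pairs w]| <=
    \sum_o \sum_(a : F | a != 0%R) relations o a ^ 3)%N.
  apply: leq_trans (card_exists_le P) _.
  apply: (@leq_trans (\sum_o \sum_a #|P (o, a)|)%N).
    by rewrite pair_bigA; apply: leq_sum => -[].
  by apply: leq_sum => o _; rewrite [leqRHS]big_mkcond; apply: leq_sum => a _.
have c2 o : (\sum_(a : F | a != 0%R) relations o a ^ 3 <=
    (N ^ 2 * max_level o) ^ 2 * (N ^ 2 * N ^ 2 + N * (q * N)))%N.
  apply: leq_trans (leq_mul (leqnn _) (sum_relations o)).
  rewrite big_distrr /=; apply: leq_sum => a _; rewrite expnSr leq_mul2r leq_sqr.
  by rewrite relations_le_max orbT.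
have c3 : (#|[pred w | dependent_pairs w]| <=
    \sum_o max_level o ^ 2 * (9 * N ^ 8))%N.
  apply: leq_trans c1 _; apply: leq_sum => o _; apply: leq_trans (c2 o) _.
  rewrite expnMn -mulnA [(_ * (max_level o ^ 2 * _))%N]mulnCA leq_mul2l; apply/orP; right.
  have -> : (9 * N ^ 8 = (N ^ 2) ^ 2 * (N ^ 2 * N ^ 2 + N * (8 * N ^ 2 * N)))%N by ring.
  by rewrite !leq_mul2l leq_add2l !leq_mul2l leq_mul2r qN !orbT.
apply: (@le_trans _ _ (\sum_o max_level o ^ 2 * (9 * N ^ 8))%:R); first by rewrite ler_nat.
rewrite -big_distrl natrM natr_sum /= natrM natrX.
under eq_bigr do rewrite natrX.
have := sum_max_level_sqr; set x := N%:R; set h := harmonic_sum R N => h1.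
have -> : 225 * x ^+ 10 * h ^+ 2 = (25 * x ^+ 2 * h ^+ 2) * (9 * x ^+ 8) by ring.
by rewrite ler_wpM2r// mulr_ge0// exprn_ge0.
Qed.

End DependentPairs.

(** * Fixed flags of a matrix: linear algebra *)

Section Kernels.
Variable F : finFieldType.
Local Notation q := #|F|.
Local Notation V := 'cV[F]_3.
Implicit Types (M g : 'M[F]_3) (u v w : V).

Definition ker_size M := #|[pred v : V | M *m v == 0]|.

Definition line_image M := [exists u : V, [forall v : V, [exists c : F, M *m v == c *: u]]].

Lemma card_colvec : #|{: V}| = (q ^ 3)%N.
Proof. by rewrite card_mx muln1. Qed.

Lemma fiber_le_ker M u : (#|[pred v : V | M *m v == u]| <= ker_size M)%N.
Proof.
case: (pickP [pred v : V | M *m v == u]) => [v0 /eqP h0|h]; last by rewrite (eq_card0 h).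
apply: (card_le_inj (f := fun v => v - v0)) => [v w _ _|v /eqP hv] /=.
  exact: addIr.
by rewrite mulmxBr hv h0 subrr.
Qed.

(** Rank and nullity in counting form: nonempty fibres are cosets of the kernel. *)
Lemma ker_image_le M (A : {set V}) : (forall u, u \in A -> exists v, M *m v = u) ->
  (ker_size M * #|A| <= q ^ 3)%N.
Proof.
move=> Aim; have -> : (ker_size M * #|A| = \sum_(u in A) ker_size M)%N.
  by rewrite sum_nat_const mulnC.
have -> : (q ^ 3 = \sum_u #|[pred v : V | M *m v == u]|)%N.
  rewrite -card_colvec -sum1_card (partition_big (mulmx M) xpredT)//=.
  by apply: eq_bigr => u _; rewrite -sum1_card; apply: eq_bigl.
rewrite [leqLHS]big_mkcond; apply: leq_sum => u _ /=.
case: ifPn => // /Aim[v0 h0].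
apply: (card_le_inj (f := fun v => v + v0)) => [v w _ _|v /eqP hv] /=.
  exact: addIr.
by rewrite mulmxDr hv h0 add0r.
Qed.

Let q0 : (0 < q)%N. Proof. by apply/card_gt0P; exists 0. Qed.

Lemma ker_size_neq0 M : M != 0 -> (ker_size M <= q ^ 2)%N.
Proof.
move=> M0; have [v v0] : exists v : V, M *m v != 0.
  apply/existsP; apply: contraNT M0; rewrite negb_exists => /forallP h.
  apply/eqP/matrixP => i j; have := h (delta_mx j 0); rewrite negbK => /eqP/matrixP/(_ i 0).
  by rewrite -colE !mxE.
have cI : injective (fun c : F => c *: (M *m v)).
  by move=> c d /eqP; rewrite -subr_eq0 -scalerBl scaler_eq0 (negPf v0) orbF subr_eq0 => /eqP.
have := @ker_image_le M [set c *: (M *m v) | c : F]%SET.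
rewrite finset.card_imset// expnSr leq_pmul2r//; apply => u /finset.imsetP[c _ ->].
by exists (c *: v); rewrite scalemxAr.
Qed.

Lemma ker_size_rank2 M : ~~ line_image M -> (ker_size M <= q)%N.
Proof.
move=> nl.
have [v1 v10] : exists v : V, M *m v != 0.
  apply/existsP; apply: contraNT nl; rewrite negb_exists => /forallP h.
  apply/existsP; exists 0; apply/forallP => v; apply/existsP; exists 0.
  by rewrite scaler0; have := h v; rewrite negbK.
have [v2 v20] : exists v2 : V, forall c, M *m v2 != c *: (M *m v1).
  move: nl; rewrite negb_exists => /forallP/(_ (M *m v1)); rewrite negb_forall.
  by case/existsP => v2; rewrite negb_exists => /forallP; exists v2.
have cI : injective (fun c : F * F => c.1 *: (M *m v1) + c.2 *: (M *m v2)).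
  move=> [c1 c2] [d1 d2] /= /eqP; rewrite -subr_eq0 opprD addrACA -!scalerBl.
  have [/eqP|n2] := eqVneq (c2 - d2) 0.
    rewrite subr_eq0 => /eqP ->; rewrite subrr scale0r addr0 scaler_eq0 (negPf v10) orbF.
    by rewrite subr_eq0 => /eqP ->.
  rewrite addr_eq0 => /eqP e; have := v20 (- (c1 - d1) / (c2 - d2)).
  by rewrite mulrC -scalerA scaleNr e opprK scalerA mulVf// scale1r eqxx.
have := @ker_image_le M [set c.1 *: (M *m v1) + c.2 *: (M *m v2) | c : F * F]%SET.
rewrite finset.card_imset// card_prod expnS -mulnn leq_pmul2r ?muln_gt0 ?q0//; apply.
move=> u /finset.imsetP[c _ ->].
by exists (c.1 *: v1 + c.2 *: v2); rewrite mulmxDr !scalemxAr.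
Qed.

Lemma eigenvector_root g (a : F) v : v != 0 -> g *m v = a *: v -> root (char_poly g) a.
Proof.
move=> v0 gv; rewrite -eigenvalue_root_char; apply: contraT; rewrite /eigenvalue negbK.
rewrite /eigenspace kermx_eq0 row_free_unit => ug; move/eqP: v0; case.
by rewrite -(mulKmx ug v) mulmxBl gv mul_scalar_mx subrr mulmx0.
Qed.

Lemma card_eigenvalues g : (#|[pred a | root (char_poly g) a]| <= 3)%N.
Proof.
have p0 : char_poly g != 0 by rewrite monic_neq0 ?char_poly_monic.
rewrite cardE -ltnS -(size_char_poly g); apply: max_poly_roots => //.
  by apply/allP => a; rewrite mem_enum.
exact: enum_uniq.
Qed.

(* Adapted bases [(v, w)] of the flags fixed by [g]. *)
Definition fixed_pair g (p : V * V) :=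
  [&& p.1 != 0, [forall a : F, p.2 != a *: p.1],
      [exists a : F, g *m p.1 == a *: p.1] &
      [exists b : F, [exists c : F, g *m p.2 == b *: p.2 + c *: p.1]]].

Let shift g a : 'M[F]_3 := g - a%:M.
Let eigen_pair g a b := [pred p : V * V | (shift g a *m p.1 == 0) &&
   [exists c : F, shift g b *m p.2 == c *: p.1]].

Let shiftE g a v : shift g a *m v = g *m v - a *: v.
Proof. by rewrite mulmxBl mul_scalar_mx. Qed.

(** The scalar [b] by which [g] acts on the plane modulo the line is also an eigenvalue: if [b]
    differs from [a], an eigenvector is [p.2 - (c / (a - b)) *: p.1]. At most three eigenvalues
    leave nine choices of [(a, b)]. *)
Lemma card_fixed_pair_le g (T : nat) :
  (forall a b, (#|eigen_pair g a b| <= T)%N) ->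
  (#|[pred p | fixed_pair g p]| <= 9 * T)%N.
Proof.
move=> hT; pose E := [pred a | root (char_poly g) a].
pose P (ab : F * F) := [pred p | (ab.1 \in E) && (ab.2 \in E) && eigen_pair g ab.1 ab.2 p].
apply: (@leq_trans #|[pred p | [exists ab, P ab p]]|).
  apply: card_le_sub => p; rewrite !inE.
  case/and4P => v0 /forallP nw /existsP[a /eqP ha] /existsP[b /existsP[c /eqP hb]].
  apply/existsP; exists (a, b); rewrite /= !inE (eigenvector_root v0 ha) /=.
  rewrite !shiftE ha subrr eqxx /= hb addrAC subrr add0r.
  apply/andP; split; last by apply/existsP; exists c.
  have [<-|ab] := eqVneq a b; first exact: eigenvector_root v0 ha.
  have ab0 : a - b != 0 by rewrite subr_eq0.
  apply: (@eigenvector_root _ _ (p.2 - (c / (a - b)) *: p.1)).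
    by have := nw (c / (a - b)); rewrite subr_eq0.
  rewrite mulmxBr -scalemxAr ha hb scalerBr !scalerA -addrA; congr (_ + _).
  rewrite -!scaleNr -scalerDl; congr (_ *: _); by field.
apply: leq_trans (card_exists_le P) _.
apply: (@leq_trans (\sum_(ab : F * F) if (ab.1 \in E) && (ab.2 \in E) then T else 0)).
  apply: leq_sum => ab _; case: ifPn => h; last first.
    by rewrite leqn0; apply/eqP/eq_card0 => p; rewrite !inE (negPf h).
  by apply: leq_trans (hT ab.1 ab.2); apply: card_le_sub => p /andP[].
rewrite -big_mkcond sum_nat_const leq_mul2r; apply/orP; right.
apply: (@leq_trans (#|E| * #|E|)%N); last first.
  exact: (leq_mul (card_eigenvalues g) (card_eigenvalues g)).
by rewrite -cardX; apply: card_le_sub => -[a b].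
Qed.

Let second_le g b v : (#|[pred w : V | [exists c : F, shift g b *m w == c *: v]]| <=
  ker_size (shift g b) + if [exists w, shift g b *m w == v] then q * ker_size (shift g b) else 0)%N.
Proof.
case: ifPn => [_|nim].
  apply: leq_trans (leq_addl _ _).
  apply: leq_trans (card_exists_le (fun c => [pred w | shift g b *m w == c *: v])) _.
  by rewrite -sum_nat_const; apply: leq_sum => c _; apply: fiber_le_ker.
rewrite addn0; apply: card_le_sub => w; rewrite !inE => /existsP[c /eqP hc].
have [c0|c0] := eqVneq c 0; first by rewrite hc c0 scale0r.
move/negP: nim; case; apply/existsP; exists (c^-1 *: w).
by rewrite -scalemxAr hc scalerA mulVf// scale1r.
Qed.

(** Vectors [v] outside the image of [shift g b] admit only [c = 0], which costs two kernels of size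
    at most [q ^ 2]. Those inside cost [q * ker_size] each, but image and kernel sizes multiply to
    at most [q ^ 3]. Both parts are at most [q ^ 4]. *)
Lemma card_fixed_pair_nonscalar g : (forall a, g != a%:M) ->
  (#|[pred p | fixed_pair g p]| <= 18 * q ^ 4)%N.
Proof.
move=> ng; have -> : (18 * q ^ 4 = 9 * (q ^ 4 + q ^ 4))%N by lia.
apply: card_fixed_pair_le => a b.
have kM c : (ker_size (shift g c) <= q ^ 2)%N by apply: ker_size_neq0; rewrite subr_eq0.
rewrite card_pair_sum.
apply: (@leq_trans (\sum_(v : V | shift g a *m v == 0%R) ker_size (shift g b) +
  \sum_(v : V) if [exists w, shift g b *m w == v] then q * ker_size (shift g b) else 0)%N).
  rewrite [X in (X + _)%N]big_mkcond -big_split; apply: leq_sum => v _ /=.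
  case: ifPn => [va|va]; last by rewrite (eq_card0)// => w; rewrite !inE /= (negPf va).
  by apply: leq_trans (second_le g b v); apply: card_le_sub => w /andP[].
apply: leq_add.
  rewrite sum_nat_const; apply: leq_trans (leq_mul (kM a) (kM b)) _.
  by rewrite -expnD.
rewrite -big_mkcond sum_nat_const.
have := @ker_image_le (shift g b) [set v | [exists w, shift g b *m w == v]]%SET.
rewrite finset.cardsE => H; rewrite mulnCA [(q ^ 4)%N]expnS leq_pmul2l// mulnC.
by apply: H => u; rewrite inE => /existsP[w /eqP]; exists w.
Qed.

Lemma card_fixed_pair_regular g : (forall a, ~~ line_image (g - a%:M)) ->
  (#|[pred p | fixed_pair g p]| <= 9 * q ^ 3)%N.
Proof.
move=> ng; apply: card_fixed_pair_le => a b.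
have kM c : (ker_size (shift g c) <= q)%N := ker_size_rank2 (ng c).
apply: (@leq_trans (#|[pred v : V | shift g a *m v == 0%R]| * (q * q))%N).
  apply: card_pair_le => [v w /andP[]//|v].
  apply: (@leq_trans #|[pred w : V | [exists c : F, shift g b *m w == c *: v]]|).
    by apply: card_le_sub => w /andP[].
  apply: leq_trans (card_exists_le (fun c => [pred w | shift g b *m w == c *: v])) _.
  rewrite -sum_nat_const; apply: leq_sum => c _.
  by apply: leq_trans (fiber_le_ker _ _) (kM b).
by rewrite !expnS expn0 muln1 leq_mul2r kM orbT.
Qed.

Lemma card_fixed_pair g : (#|[pred p | fixed_pair g p]| <= q ^ 6)%N.
Proof. by apply: leq_trans (max_card _) _; rewrite card_prod card_colvec -expnD. Qed.

End Kernels.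

(** * The action on flags *)

Section Flags.
Variable F : finFieldType.
Local Notation q := #|F|.
Local Notation V := 'cV[F]_3.
Implicit Types (A B : 'M[F]_3) (v w : V).

Definition flag_over : finType :=
  {W : {vspace 'cV[F]_3} * {vspace 'cV[F]_3} | complete_flag W}.
Implicit Types x y : flag_over.

(** Made total for all matrices: [x] itself is the default when the image is not a complete flag. *)
Definition mx_act A x : flag_over :=
  insubd x (vspace_act A (val x).1, vspace_act A (val x).2).

Lemma val_mx_act A x : A \in unitmx ->
  val (mx_act A x) = (vspace_act A (val x).1, vspace_act A (val x).2).
Proof.
move=> uA; rewrite /mx_act val_insubd; have /and3P[d1 d2 s] := valP x.
by rewrite /complete_flag /= !dim_vspace_act// d1 d2 limgS.
Qed.

Lemma mx_act1 x : mx_act 1%:M x = x.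
Proof.
apply: val_inj; rewrite val_mx_act ?unitmx1// !vspace_act1.
by rewrite -surjective_pairing.
Qed.

Lemma mx_actM A B x : A \in unitmx -> B \in unitmx ->
  mx_act (A *m B) x = mx_act A (mx_act B x).
Proof.
move=> uA uB; apply: val_inj.
by rewrite !val_mx_act ?unitmx_mul ?uA// !vspace_actM.
Qed.

Definition adapted x (p : V * V) :=
  [&& p.1 != 0, p.1 \in (val x).1, p.2 \in (val x).2 & p.2 \notin (val x).1].

Lemma adapted_ex x : exists p, adapted x p.
Proof.
have /and3P[/eqP d1 /eqP d2 s] := valP x.
have v0 : vpick (val x).1 != 0 by rewrite vpick0 -dimv_eq0 d1.
have /subvPn[w w2 w1] : ~~ ((val x).2 <= (val x).1)%VS.
  by apply/negP => /dimvS; rewrite d1 d2.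
by exists (vpick (val x).1, w); rewrite /adapted v0 memv_pick w2 w1.
Qed.

Lemma adapted_line x p : adapted x p -> (val x).1 = <[p.1]>%VS.
Proof.
move=> /and4P[v0 v1 _ _]; have /and3P[/eqP d1 _ _] := valP x.
by apply/esym/eqP; rewrite eqEdim -memvE v1 d1 dim_vline v0.
Qed.

Lemma adapted_plane x p : adapted x p -> (val x).2 = (<[p.1]> + <[p.2]>)%VS.
Proof.
move=> px; have e1 := adapted_line px; move: px => /and4P[v0 v1 w2 w1].
have /and3P[/eqP d1 /eqP d2 s] := valP x.
apply/esym/eqP; rewrite eqEdim subv_add -!memvE w2 (subvP s _ v1) d2 /=.
rewrite leqNgt ltnS; apply: contra w1 => d.
have : (<[p.1]> == <[p.1]> + <[p.2]>)%VS by rewrite eqEdim addvSl dim_vline v0.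
by rewrite e1 => /eqP ->; rewrite memvE addvSr.
Qed.

Lemma adapted_eq x y p : adapted x p -> adapted y p -> x = y.
Proof.
move=> px py; apply: val_inj.
rewrite [LHS]surjective_pairing [RHS]surjective_pairing.
by rewrite (adapted_line px) (adapted_line py) (adapted_plane px) (adapted_plane py).
Qed.

Lemma adapted_act A x p : A \in unitmx -> adapted x p ->
  adapted (mx_act A x) (A *m p.1, A *m p.2).
Proof.
move=> uA px; have mulI v : A *m v = 0 -> v = 0.
  by move=> e; rewrite -(mulKmx uA v) e mulmx0.
have img (U : {vspace V}) v : (A *m v \in vspace_act A U) = (v \in U).
  apply/memv_imgP/idP => [[u uU]|vU]; last by exists v; rewrite ?lfunE.
  by rewrite lfunE /= => /(congr1 (mulmx (invmx A))); rewrite !mulKmx// => ->.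
rewrite /adapted val_mx_act// !img; case/and4P: px => v0 -> -> ->.
by rewrite !andbT; apply: contra_neq v0 => /mulI.
Qed.

Lemma card_adapted x : (q.-1 * q.-1 * q <= #|[pred p | adapted x p]|)%N.
Proof.
have [[v w] /and4P[v0 v1 w2 w1]] := adapted_ex x.
have /and3P[_ _ s] := valP x.
have cF0 : #|[pred c : F | c != 0]| = q.-1 by have := cardC1 (0 : F).
have -> : (q.-1 * q.-1 * q = #|[pred t : F * F * F | (t.1.1 != 0%R) && (t.1.2 != 0%R)]|)%N.
  rewrite -{1 2}cF0 -cardX -[X in (_ * X)%N]cardsT -cardX.
  by apply: eq_card => -[[c d] e]; rewrite !inE !andbT.
apply: (card_le_inj (f := fun t => (t.1.1 *: v, t.1.2 *: w + t.2 *: v))); last first.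
  move=> [[c d] e] /= /andP[c0 d0]; rewrite /adapted /= scaler_eq0 negb_or c0 v0.
  rewrite memvZ//= memvD ?memvZ ?(subvP s _ v1)//=.
  apply: contra w1 => h; rewrite -[w](scalerK d0) memvZ//.
  by rewrite -[d *: w](addrK (e *: v)) memvB// memvZ.
move=> [[c1 c2] c3] [[d1 d2] d3] _ _ /= e.
have e1 : c1 = d1.
  have /eqP := congr1 fst e; rewrite /= -subr_eq0 -scalerBl scaler_eq0 (negPf v0) orbF.
  by rewrite subr_eq0 => /eqP.
have /= e2 := congr1 snd e.
have e3 : (c2 - d2) *: w = (d3 - c3) *: v.
  by apply: (addIr (c3 *: v)); rewrite !scalerBl subrK addrAC e2 addrAC subrr add0r.
have c2d2 : c2 = d2.
  apply/eqP; rewrite -subr_eq0; apply: contraT => n; move/negP: w1; case.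
  by rewrite -[w](scalerK n) e3 !memvZ.
move: e3; rewrite c2d2 subrr scale0r => /esym/eqP; rewrite scaler_eq0 (negPf v0) orbF.
by rewrite subr_eq0 e1 => /eqP ->.
Qed.

(** The cross product of [v] and [w] is nonzero, so some third column [z] pairs with it to 1, and
    this pairing is the determinant. *)
Lemma independent_columns v w : v != 0 -> (forall c : F, w != c *: v) ->
  exists A, [/\ \det A = 1, A *m delta_mx 0 0 = v & A *m delta_mx 1 0 = w].
Proof.
move=> v0 nw.
pose c0 := v 1 0 * w 2 0 - v 2 0 * w 1 0; pose c1 := v 2 0 * w 0 0 - v 0 0 * w 2 0.
pose c2 := v 0 0 * w 1 0 - v 1 0 * w 0 0.
have [z hz] : exists z : 'I_3 -> F, z 0 * c0 + z 1 * c1 + z 2 * c2 = 1.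
  have [n0|n0] := eqVneq c0 0; last first.
    by exists (fun i => if i == 0 then c0^-1 else 0) => /=; rewrite mulVf// !mul0r !addr0.
  have [n1|n1] := eqVneq c1 0; last first.
    by exists (fun i => if i == 1 then c1^-1 else 0) => /=; rewrite mulVf// !mul0r addr0 add0r.
  have [n2|n2] := eqVneq c2 0; last first.
    by exists (fun i => if i == 2 then c2^-1 else 0) => /=; rewrite mulVf// !mul0r !add0r.
  have cross i k : v i 0 * w k 0 = w i 0 * v k 0.
    move/eqP: n0; move/eqP: n1; move/eqP: n2; rewrite !subr_eq0 => /eqP h2 /eqP h1 /eqP h0.
    case: (I3P i) => ->; case: (I3P k) => ->; rewrite [RHS]mulrC //;
      solve [exact: h0 | exact: h1 | exact: h2 | exact: esym h0 | exact: esym h1 | exact: esym h2].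
  have [i vi] : exists i, v i 0 != 0.
    apply/existsP; apply: contraNT v0; rewrite negb_exists => /forallP h.
    by apply/eqP/matrixP => i j; rewrite ord1 mxE; have := h i; rewrite negbK => /eqP.
  have := nw (w i 0 / v i 0); case/negP; apply/eqP/matrixP => k j.
  by rewrite ord1 mxE mulrAC -cross mulrC mulKf.
pose A : 'M[F]_3 := \matrix_(i, j) match val j with 0%N => v i 0 | 1%N => w i 0 | _ => z i end.
exists A; split.
- by rewrite det_mx33 !mxE /= -hz /c0 /c1 /c2; ring.
- by rewrite -colE; apply/matrixP => i j; rewrite ord1 !mxE.
- by rewrite -colE; apply/matrixP => i j; rewrite ord1 !mxE.
Qed.

Lemma adapted_indep x p : adapted x p -> p.1 != 0 /\ forall c : F, p.2 != c *: p.1.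
Proof.
move=> /and4P[v0 v1 _ w1]; split=> // c; apply: contra w1 => /eqP ->.
by rewrite memvZ.
Qed.

Lemma mx_act_trans x y : exists2 A, \det A = 1 & mx_act A x = y.
Proof.
have [p px] := adapted_ex x; have [r ry] := adapted_ex y.
have [p0 pn] := adapted_indep px; have [r0 rn] := adapted_indep ry.
have [A [dA A0 A1]] := independent_columns p0 pn.
have [B [dB B0 B1]] := independent_columns r0 rn.
have uA := det1_unitmx dA; have uB := det1_unitmx dB.
have dBA : \det (B *m invmx A) = 1 by rewrite det_mulmx det_inv dA dB invr1 mulr1.
exists (B *m invmx A) => //; apply: (@adapted_eq _ _ r) => //.
have := adapted_act (det1_unitmx dBA) px.
by rewrite -{1}A0 -A1 -!mulmxA !mulKmx// B0 B1 -surjective_pairing.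
Qed.

(** Double counting: a common image means a flag fixed by [invmx B *m A], each flag has at least
    [(q - 1) ^ 2 * q] adapted bases, and a basis determines its flag. *)
Lemma card_coincidence A B : A \in unitmx -> B \in unitmx ->
  (q.-1 * q.-1 * q * #|[pred x | mx_act A x == mx_act B x]| <=
   #|[pred p | fixed_pair (invmx B *m A) p]|)%N.
Proof.
move=> uA uB; pose g := invmx B *m A.
have ug : g \in unitmx by rewrite unitmx_mul unitmx_inv uB.
rewrite mulnC -sum_nat_const.
apply: (@leq_trans #|[pred u : flag_over * (V * V) |
    (mx_act A u.1 == mx_act B u.1) && adapted u.1 u.2]|).
  rewrite card_pair_sum [leqLHS]big_mkcond; apply: leq_sum => x _ /=.
  case: ifPn => // fx; apply: leq_trans (card_adapted x) _.
  by apply: card_le_sub => p /=; rewrite -[(_ == _)]/(x \in [pred x | mx_act A x == mx_act B x]) fx.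
apply: (card_le_inj (f := snd)).
  move=> [x p] [y r] /andP[_ px] /andP[_ ry] /= e; rewrite -e in ry *.
  by congr (_, _); apply: adapted_eq px ry.
move=> [x p] /= /andP[/eqP AB px].
have gx : mx_act g x = x.
  by rewrite mx_actM ?unitmx_inv// AB -mx_actM ?unitmx_inv// mulVmx// mx_act1.
have := adapted_act ug px; rewrite gx => /and4P[_ g1 g2 _].
have [p0 pn] := adapted_indep px.
rewrite /fixed_pair p0 /=; apply/and3P; split; first by apply/forallP.
  by move: g1; rewrite (adapted_line px) => /vlineP[a e]; apply/existsP; exists a; apply/eqP.
move: g2; rewrite (adapted_plane px) => /memv_addP[u /vlineP[c ->] [w /vlineP[b ->] e]].
by apply/existsP; exists b; apply/existsP; exists c; apply/eqP; rewrite [LHS]e addrC.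
Qed.

Let q_gt1 : (1 < q)%N.
Proof.
by apply/card_gt1P; exists 0, 1; split=> //; rewrite eq_sym oner_eq0.
Qed.

Let cube_le : (q ^ 3 <= 4 * (q.-1 * q.-1 * q))%N.
Proof.
case: q q_gt1 => // n n1; rewrite /= !expnS expn0 muln1.
have h : (n.+1 <= 2 * n)%N by lia.
rewrite !mulnA leq_mul2r /=; have := leq_mul h h; lia.
Qed.

Let coincidence_bound A B (k m : nat) : A \in unitmx -> B \in unitmx ->
  (#|[pred p | fixed_pair (invmx B *m A) p]| <= k * q ^ m.+3)%N ->
  (#|[pred x | mx_act A x == mx_act B x]| <= 4 * k * q ^ m)%N.
Proof.
move=> uA uB h; have q3 : (0 < q ^ 3)%N by rewrite expn_gt0 ltnW.
rewrite -(leq_pmul2l q3).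
apply: (@leq_trans (4 * (q.-1 * q.-1 * q) * #|[pred x | mx_act A x == mx_act B x]|)%N).
  by rewrite leq_mul2r cube_le orbT.
rewrite -mulnA; have := leq_trans (card_coincidence uA uB) h.
rewrite -(leq_pmul2l (_ : 0 < 4)%N)// => /leq_trans; apply.
by rewrite -[m.+3]addn3 expnD; lia.
Qed.

Lemma coincidence_regular A B : A \in unitmx -> B \in unitmx ->
  (forall a, ~~ line_image (A - a *: B)) ->
  (#|[pred x | mx_act A x == mx_act B x]| <= 36)%N.
Proof.
move=> uA uB h; have := @coincidence_bound A B 9 0 uA uB; rewrite !muln1; apply.
apply: card_fixed_pair_regular => a; apply: contra (h a).
move=> /existsP[u /forallP hu]; apply/existsP; exists (B *m u); apply/forallP => v.
have /existsP[c /eqP e] := hu v; apply/existsP; exists c; apply/eqP.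
rewrite scalemxAr -e mulmxA mulmxBr mulKVmx//.
by rewrite mul_mx_scalar.
Qed.

Lemma coincidence_nonscalar A B : A \in unitmx -> B \in unitmx ->
  (forall a, A != a *: B) -> (#|[pred x | mx_act A x == mx_act B x]| <= 72 * q)%N.
Proof.
move=> uA uB h; have := @coincidence_bound A B 18 1 uA uB; rewrite expn1; apply.
apply: card_fixed_pair_nonscalar => a; apply: contra_neq (h a) => e.
by rewrite -[LHS](mulKVmx uB) e mul_mx_scalar.
Qed.

(** Coincidences of the identity with itself, with the trivial count of pairs of vectors. *)
Lemma card_flag_le : (#|flag_over| <= 4 * q ^ 3)%N.
Proof.
have u1 : 1%:M \in @unitmx F 3 := unitmx1 _ _.
have := @coincidence_bound 1%:M 1%:M 1 3 u1 u1; rewrite mul1n muln1.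
move=> /(_ (card_fixed_pair _)); apply: leq_trans.
by apply: card_le_sub => x _ /=.
Qed.

End Flags.

(** * Averaging by words *)

Section Averages.
Variables (R : realType) (F : finFieldType).
Hypothesis FT : relative_T F (340 : R).
Local Notation flag := (flag_over F).
Local Notation act := (@mx_act F).
Local Notation avg := (average (R := R) act).

Lemma iter_average_contract n (f : flag -> R) : \sum_x f x = 0 ->
  \sum_x iter n avg f x ^+ 2 <= gap_factor R ^+ n * \sum_x f x ^+ 2.
Proof.
have c0 : 0 <= gap_factor R by rewrite /gap_factor; lra.
have sum0 (g : flag -> R) : \sum_x avg g x = \sum_x g x.
  exact: (average_sum (@mx_act1 F) (@mx_actM F)).
move=> f0; elim: n => [|n IH]; first by rewrite expr0 mul1r.
have fn0 : \sum_x iter n avg f x = 0.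
  by elim: n {IH} => //= n IH; rewrite sum0.
rewrite iterS; apply: le_trans.
  exact: (average_contract FT (@mx_act1 F) (@mx_actM F) (@mx_act_trans F) fn0).
by rewrite exprS -mulrA ler_wpM2l.
Qed.

Lemma iter_averageB n (f : flag -> R) m x :
  iter n avg (fun y => f y - m) x = iter n avg f x - m.
Proof.
elim: n x => // n IH x; rewrite !iterS /average.
under eq_bigr do rewrite IH.
rewrite sumrB sumr_const card_prod !card_ord mulrBr; congr (_ - _).
by rewrite -(mulr_natl m) mulrA mulVf ?mul1r// pnatr_eq0.
Qed.

End Averages.

Section IntegerWords.
Variables (R : realType) (F : finFieldType).
Local Notation flag := (flag_over F).
Local Notation act := (@mx_act F).
Local Notation avg := (average (R := R) act).
Implicit Types g h : SL3Z.

Definition reduce g : 'M[F]_3 := map_mx intr (val g).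

Lemma reduce_unit g : reduce g \in unitmx.
Proof. by rewrite unitmxE det_map_mx (eqP (valP g)) rmorph1 unitr1. Qed.

Definition bounded_by (b : int) (A : 'M[int]_3) := forall i k, `|A i k| <= b.

(** One averaging step extends the support by the inverse generators, which lift to [elem i j (-1)];
    subtracting one row from another at most doubles the entries. *)
Lemma iter_average_support n (f : flag -> R) (x : flag) (b : int) :
  (forall y, f y != 0 -> exists2 g : SL3Z, bounded_by b (val g) & act (reduce g) x = y) ->
  forall y, iter n avg f y != 0 ->
  exists2 g : SL3Z, bounded_by (2 ^+ n * b) (val g) & act (reduce g) x = y.
Proof.
move=> hf; elim: n => [|n IH] y; first by rewrite expr0 mul1r; apply: hf.
rewrite iterS /average mulf_eq0 negb_or => /andP[_ s0].
have [s fs] : exists s, iter n avg f (act (gen F s) y) != 0.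
  apply/existsP; apply: contraNT s0; rewrite negb_exists => /forallP h.
  by rewrite big1// => s _; have := h s; rewrite negbK => /eqP.
have [g gb gx] := IH _ fs.
have b0 : 0 <= 2 ^+ n * b by apply: le_trans (gb 0 0).
have [st|st] := eqVneq s.1 s.2.
  exists g; last by rewrite gx /gen st eqxx mx_act1.
  by move=> i k; apply: le_trans (gb i k) _; rewrite exprS -mulrA ler_peMl.
have dg : \det (elem s.1 s.2 (-1) *m val g) == 1.
  by rewrite det_mulmx det_elem// (eqP (valP g)) mulr1.
pose g' : SL3Z := exist (fun A : 'M[int]_3 => is_true (\det A == 1)) _ dg.
exists g'.
  move=> i k; rewrite /= elem_mulE exprS -mulrA; have := gb i k; have := gb s.2 k.
  case: ifP => _ h1 h2; last by rewrite addr0; apply: le_trans h2 _; rewrite ler_peMl.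
  apply: le_trans (ler_normD _ _) _; rewrite mulN1r normrN (mulr_natl _ 2) mulr2n.
  exact: lerD.
have ue : elem s.1 s.2 (-1) \in @unitmx F 3 by apply: elem_unitmx.
have -> : reduce g' = elem s.1 s.2 (-1) *m reduce g.
  rewrite /reduce /= map_mxM; congr (_ *m _).
  by rewrite /elem map_mxD map_mx1 map_mxZ map_delta_mx rmorphN1.
rewrite mx_actM ?reduce_unit// gx /gen (negPf st) -mx_actM ?elem_unitmx//.
rewrite (_ : elem _ _ _ *m _ = 1%:M) ?mx_act1//.
apply/matrixP => i k; rewrite elem_mulE !mxE.
have [->|is1] := eqVneq i s.1; last by rewrite /= mulr0 !addr0.
by rewrite /= [s.2 == s.1]eq_sym (negPf st) [s.2 == k]eq_sym /=; ring.
Qed.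

End IntegerWords.

(** * Equidistribution of a flag orbit *)

Section Equidistribution.
Variables (R : realType) (F : finFieldType) (q N : nat).
Hypothesis FT : relative_T F (340 : R).
Hypothesis intF : forall m : int, (m%:~R == 0 :> F) = (q%:Z %| m)%Z.
Hypothesis cardF : #|F| = q.
Hypothesis N2q : (2 * N ^ 2 < q)%N.
Hypothesis qN : (q <= 8 * N ^ 2)%N.
Hypothesis N256 : (256 <= N)%N.
Local Notation flag := (flag_over F).
Local Notation act := (@mx_act F).
Local Notation avg := (average (R := R) act).
Local Notation I := 'I_N.
Local Notation row := (I * I * I)%type.
Local Notation H := (harmonic_sum R N).

Definition admissible (u : row * row) := head_coprime u.1 && primitive_pair u.1 u.2.

Variable lift_rows : row * row -> SL3Z.
Hypothesis lift_rowsP : forall u, admissible u ->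
  [/\ forall k, val (lift_rows u) 0 k = ent (entry u.1 k),
      forall k, val (lift_rows u) 1 k = ent (entry u.2 k)
    & bounded_by (3 * N%:Z) (val (lift_rows u))].

Let gam u : 'M[F]_3 := reduce F (lift_rows u).

Let gam_unit u : gam u \in unitmx. Proof. exact: reduce_unit. Qed.

Let gam0 u k : admissible u -> gam u 0 k = (ent (entry u.1 k))%:~R.
Proof. by move=> /lift_rowsP[h _ _]; rewrite mxE h. Qed.

Let gam1 u k : admissible u -> gam u 1 k = (ent (entry u.2 k))%:~R.
Proof. by move=> /lift_rowsP[_ h _]; rewrite mxE h. Qed.

Let gam_nonscalar u u' : admissible u -> admissible u' -> u != u' ->
  forall a, gam u' != a *: gam u.
Proof.
move=> au au' uu' a; apply: contra_neq uu' => e.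
have [/andP[cu _] /andP[cu' _]] := (au, au').
have := @proportional_eq F q N intF N2q u.1 u.2 u'.1 u'.2 a cu cu'.
rewrite -!surjective_pairing => <- // k.
  by rewrite -gam0// -gam0// e mxE.
by rewrite -gam1// -gam1// e mxE.
Qed.

(** If the image is spanned by [z], a linear form in the first two coordinates that kills [z] gives
    the relation; [a] is nonzero because [gam u'] is invertible and so has rank above 1. *)
Let gam_regular u u' : admissible u -> admissible u' ->
  ~~ dependent_pairs F (u, u') -> forall a, ~~ line_image (gam u' - a *: gam u).
Proof.
move=> au au' nd a; apply: contra nd => /existsP[z /forallP hz].
have zE v : exists c, (gam u' - a *: gam u) *m v = c *: z.
  by have /existsP[c /eqP] := hz v; exists c.
have a0 : a != 0.
  apply/eqP => a0; rewrite a0 scale0r subr0 in zE.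
  have lin v : exists c, v = c *: z.
    by have [c e] := zE (invmx (gam u') *m v); exists c; rewrite -e mulKVmx ?gam_unit.
  have [c /matrixP ec] := lin (delta_mx 0 0); have [d /matrixP ed] := lin (delta_mx 1 0).
  have := ec 0 0; have := ed 0 0; have := ed 1 0; rewrite !mxE /= => e1 e2 e3.
  have z0 : z 0 0 != 0 by apply: contra_eq_neq e3 => ->; rewrite mulr0 oner_eq0.
  move/esym/eqP: e2; rewrite mulf_eq0 (negPf z0) orbF => /eqP d0.
  by move/eqP: e1; rewrite d0 mul0r oner_eq0.
have col k : exists c, gam u' 0 k - a * gam u 0 k = c * z 0 0 /\
    gam u' 1 k - a * gam u 1 k = c * z 1 0.
  have [c] := zE (delta_mx k 0); rewrite -colE => /matrixP e; exists c.
  by have := e 0 0; have := e 1 0; rewrite !mxE => -> ->.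
pose o : option F := if z 1 0 == 0 then None else Some (- (z 0 0 / z 1 0)).
apply/existsP; exists (o, a); rewrite a0; apply/forallP => k /=.
rewrite -subr_eq0 /pair_lin /lin /o; have [c [e0 e1]] := col k.
rewrite !gam0// in e0; rewrite !gam1// in e1.
have [z1|z1] := eqVneq (z 1 0) 0; first by rewrite e1 z1 mulr0.
set w := - _; rewrite (_ : _ - _ = c * z 0 0 + w * (c * z 1 0)); last by rewrite -e0 -e1; ring.
by rewrite /w; apply/eqP; field.
Qed.

Definition coincidences (u u' : row * row) :=
  #|[pred x : flag | act (gam u') x == act (gam u) x]|.

Let q_le : q%:R <= 8 * N%:R ^+ 2 :> R.
Proof. by rewrite -natrX -natrM ler_nat. Qed.

(** With [q <= 8 * N ^ 2], generic, degenerate and diagonal pairs all contribute order [N ^ 12]; the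
    logarithms come from the degenerate pairs only. *)
Lemma sum_coincidences :
  \sum_(u | admissible u) \sum_(u' | admissible u') (coincidences u u')%:R <=
  (36 + 72 * 8 * 225 + 4 * 8 ^+ 3) * N%:R ^+ 12 * H ^+ 2 :> R.
Proof.
have flag_le : #|flag|%:R <= 4 * q%:R ^+ 3 :> R.
  by rewrite -natrX -natrM ler_nat -cardF card_flag_le.
have pt u u' : admissible u -> admissible u' -> (coincidences u u')%:R <=
   36 + 72 * q%:R * (dependent_pairs F (u, u'))%:R + 4 * q%:R ^+ 3 * (u == u')%:R :> R.
  move=> au au'; have [<-|uu'] := eqVneq u u'.
    have h : 0 <= 72 * q%:R * (dependent_pairs F (u, u))%:R :> R by rewrite !mulr_ge0.
    have : (coincidences u u)%:R <= #|flag|%:R :> R by rewrite ler_nat max_card.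
    by rewrite mulr1; lra.
  rewrite mulr0 addr0; case: (boolP (dependent_pairs F _)) => [_|nd].
    apply: (@le_trans _ _ (72 * q)%:R); last by rewrite natrM mulr1 lerDr.
    rewrite ler_nat -cardF; apply: coincidence_nonscalar; rewrite ?gam_unit//.
    exact: gam_nonscalar.
  rewrite mulr0 addr0 ler_nat; apply: coincidence_regular; rewrite ?gam_unit//.
  exact: gam_regular.
have c6 : #|{: row * row}| = (N ^ 6)%N.
  by rewrite !card_prod !card_ord; ring.
have sumform (k1 k2 k3 : R) : \sum_(u : row * row) \sum_(u' : row * row)
    (k1 + k2 * (dependent_pairs F (u, u'))%:R + k3 * (u == u')%:R) =
    k1 * N%:R ^+ 12 +
    k2 * #|[pred w : (row * row) * (row * row) | dependent_pairs F w]|%:R +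
    k3 * N%:R ^+ 6.
  under eq_bigr do rewrite !big_split /= -!mulr_sumr sumr_const c6.
  rewrite !big_split /= -!mulr_sumr sumr_const c6 -mulrnA; congr (_ + _ * _ + _ * _).
  - by rewrite -[LHS]mulr_natr natrM !natrX; ring.
  - rewrite card_pair_sum natr_sum; apply: eq_bigr => u _.
    rewrite -sum1_card natr_sum [RHS]big_mkcond; apply: eq_bigr => u' _.
    by rewrite inE /=; case: (dependent_pairs _ _).
  - rewrite -natrX -c6 -sum1_card natr_sum; apply: eq_bigr => u _.
    by rewrite (bigD1 u)//= eqxx big1 ?addr0// => u' /negPf; rewrite eq_sym => ->.
have x1 : 1 <= N%:R :> R by rewrite ler1n (leq_trans _ N256).
have H1 : 1 <= H by apply: harmonic_sum_ge1; apply: leq_trans N256.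
apply: (@le_trans _ _ (\sum_u \sum_u' (36 + 72 * q%:R * (dependent_pairs F (u, u'))%:R +
   4 * q%:R ^+ 3 * (u == u')%:R))).
  have pos u u' : 0 <= 36 + 72 * q%:R * (dependent_pairs F (u, u'))%:R +
      4 * q%:R ^+ 3 * (u == u')%:R :> R by rewrite !addr_ge0 ?mulr_ge0 ?exprn_ge0.
  rewrite big_mkcond /=; apply: ler_sum => u _; case: ifPn => au; last by rewrite sumr_ge0.
  rewrite big_mkcond /=; apply: ler_sum => u' _; case: ifPn => au' //.
  exact: pt.
rewrite sumform.
have := @card_dependent_pairs R F q N intF cardF N2q qN.
set D := #|_|%:R; set h := H ^+ 2.
set x := N%:R in x1 *; move=> hD.
have h1 : 1 <= h by rewrite /h exprn_ege1.
have x0 : 0 <= x by apply: le_trans x1.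
have xp k : 0 <= x ^+ k by rewrite exprn_ge0.
have t1 : 36 * x ^+ 12 <= 36 * x ^+ 12 * h by rewrite ler_peMr// mulr_ge0.
have t2 : 72 * q%:R * D <= 72 * 8 * 225 * x ^+ 12 * h.
  apply: (@le_trans _ _ (72 * (8 * x ^+ 2) * (225 * x ^+ 10 * h))).
    by rewrite ler_pM// ?mulr_ge0// ler_pM2l.
  by rewrite le_eqVlt; apply/orP; left; apply/eqP; ring.
have t3 : 4 * q%:R ^+ 3 * x ^+ 6 <= 4 * 8 ^+ 3 * x ^+ 12 * h.
  apply: (@le_trans _ _ (4 * (8 * x ^+ 2) ^+ 3 * x ^+ 6)).
    by rewrite ler_wpM2r// ler_pM2l// lerXn2r// nnegrE ?mulr_ge0.
  have -> : 4 * (8 * x ^+ 2) ^+ 3 * x ^+ 6 = 4 * 8 ^+ 3 * x ^+ 12 by ring.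
  by rewrite ler_peMr// !mulr_ge0 ?exprn_ge0.
lra.
Qed.

Definition hits (x y : flag) : R := \sum_(u | admissible u) (act (gam u) x == y)%:R.

Definition missed n (x : flag) : {set flag} := [set y | iter n avg (hits x) y == 0]%SET.

Lemma sum_hits x : \sum_y hits x y = #|[pred u | admissible u]|%:R.
Proof.
rewrite exchange_big /= -sum1_card natr_sum; apply: eq_bigr => u _.
rewrite (bigD1 (act (gam u) x)) //= eqxx big1 ?addr0// => y.
by rewrite eq_sym => /negPf ->.
Qed.

Lemma sum_sqr_hits : \sum_x \sum_y hits x y ^+ 2 =
  \sum_(u | admissible u) \sum_(u' | admissible u') (coincidences u u')%:R.
Proof.
transitivity (\sum_(x : flag) \sum_(u | admissible u) \sum_(u' | admissible u')
    ((act (gam u') x == act (gam u) x)%:R : R)).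
  apply: eq_bigr => x _; under eq_bigr do rewrite expr2 big_distrlr /=.
  rewrite exchange_big /=; apply: eq_bigr => u _.
  rewrite exchange_big /=; apply: eq_bigr => u' _.
  rewrite (bigD1 (act (gam u) x)) //= eqxx mul1r big1 ?addr0// => y.
  by rewrite eq_sym => /negPf ->; rewrite mul0r.
rewrite exchange_big /=; apply: eq_bigr => u _.
rewrite exchange_big /=; apply: eq_bigr => u' _.
by rewrite /coincidences -sum1_card natr_sum [RHS]big_mkcond; apply: eq_bigr => x _;
  rewrite inE /=; case: (_ == _).
Qed.

Lemma missedP n x y : y \notin missed n x ->
  exists2 g : SL3Z, bounded_by (2 ^+ n * (3 * N%:Z)) (val g) & act (reduce F g) x = y.
Proof.
rewrite inE; apply: iter_average_support => z hz.
have [u /andP[au /eqP uz]] : exists u, admissible u && (act (gam u) x == z).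
  apply/existsP; apply: contraNT hz; rewrite negb_exists => /forallP h.
  by rewrite /hits big1// => u au; have := h u; rewrite au /= => /negPf ->.
by exists (lift_rows u) => //; have [] := lift_rowsP au.
Qed.

(** Chebyshev's inequality: averaging keeps the mean, and on the missed set the function deviates
    from it by the whole mean. *)
Lemma card_missed_le n x :
  #|missed n x|%:R * #|[pred u | admissible u]|%:R ^+ 2 <=
  #|flag|%:R ^+ 2 * (gap_factor R ^+ n * \sum_y hits x y ^+ 2).
Proof.
set a : R := #|[pred u | admissible u]|%:R; set B : R := #|flag|%:R.
have B0 : 0 < B by rewrite ltr0n; apply/card_gt0P; exists x.
pose m := a / B; have mB : m * B = a by rewrite divfK ?gt_eqF.
have sumc (c : R) : \sum_(y : flag) c = c * B by rewrite sumr_const -mulr_natr.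
have mean0 : \sum_y (hits x y - m) = 0.
  by rewrite sumrB sum_hits sumc mB subrr.
have := iter_average_contract FT n mean0.
under eq_bigr do rewrite iter_averageB.
have -> : \sum_y (hits x y - m) ^+ 2 = \sum_y hits x y ^+ 2 - m ^+ 2 * B.
  have -> : \sum_y (hits x y - m) ^+ 2 =
      \sum_y hits x y ^+ 2 - 2 * m * \sum_y hits x y + \sum_(y : flag) m ^+ 2.
    by rewrite mulr_sumr -sumrB -big_split; apply: eq_bigr => y _ /=; ring.
  by rewrite sum_hits -/a -mB sumc; ring.
have bad_le : #|missed n x|%:R * m ^+ 2 <= \sum_y (iter n avg (hits x) y - m) ^+ 2.
  rewrite -sum1_card natr_sum mulr_suml big_mkcond /=; apply: ler_sum => y _.
  case: ifPn => [|_]; last exact: sqr_ge0.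
  by rewrite inE => /eqP ->; rewrite sub0r sqrrN mul1r.
have r0 : 0 <= gap_factor R ^+ n by rewrite exprn_ge0// /gap_factor; lra.
move=> var; have le : #|missed n x|%:R * m ^+ 2 <= gap_factor R ^+ n * \sum_y hits x y ^+ 2.
  apply: le_trans bad_le (le_trans var _); rewrite ler_wpM2l// gerBl.
  by rewrite mulr_ge0 ?sqr_ge0// ltW.
have -> : #|missed n x|%:R * a ^+ 2 = B ^+ 2 * (#|missed n x|%:R * m ^+ 2).
  by rewrite -mB; ring.
by rewrite ler_wpM2l// sqr_ge0.
Qed.

Lemma sum_missed_le n : \sum_x #|missed n x|%:R <=
  #|flag|%:R ^+ 2 * (gap_factor R ^+ n *
    ((36 + 72 * 8 * 225 + 4 * 8 ^+ 3) * 128 ^+ 2 * H ^+ 2)).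
Proof.
have x12 : 0 < N%:R ^+ 12 :> R by rewrite exprn_gt0// ltr0n (leq_trans _ N256).
have r0 : 0 <= gap_factor R ^+ n by rewrite exprn_ge0// /gap_factor; lra.
rewrite -(ler_pM2r x12).
have aN := card_admissible R N256.
set a := #|_|%:R in aN; have a2 : N%:R ^+ 12 <= 128 ^+ 2 * a ^+ 2.
  have -> : 128 ^+ 2 * a ^+ 2 = (128 * a) ^+ 2 by ring.
  rewrite -[12%N]/(6 * 2)%N exprM lerXn2r ?nnegrE ?exprn_ge0 ?mulr_ge0//.
  by move: aN; rewrite ler_pdivrMr// mulrC.
apply: (@le_trans _ _ (128 ^+ 2 * (\sum_x #|missed n x|%:R * a ^+ 2))).
  rewrite -mulr_suml; set S := \sum_x _; have S0 : 0 <= S by apply: sumr_ge0.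
  by rewrite [leRHS](_ : _ = S * (128 ^+ 2 * a ^+ 2)) ?ler_wpM2l//; ring.
apply: (@le_trans _ _ (128 ^+ 2 * (\sum_x #|flag|%:R ^+ 2 *
    (gap_factor R ^+ n * \sum_y hits x y ^+ 2)))).
  rewrite ler_wpM2l ?exprn_ge0//; apply: ler_sum => x _; exact: card_missed_le.
rewrite -!mulr_sumr sum_sqr_hits.
apply: (@le_trans _ _ (128 ^+ 2 * (#|flag|%:R ^+ 2 * (gap_factor R ^+ n *
  ((36 + 72 * 8 * 225 + 4 * 8 ^+ 3) * N%:R ^+ 12 * H ^+ 2))))).
  rewrite ler_wpM2l ?exprn_ge0// ler_wpM2l ?sqr_ge0// ler_wpM2l//.
  exact: sum_coincidences.
rewrite le_eqVlt; apply/orP; left; apply/eqP.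
move: (36 + _ + _ : R) (_ ^+ n) => c r; ring.
Qed.

End Equidistribution.

(** * Choice of the parameters *)

Lemma intr_Fp_eq0 (q : nat) (m : int) : prime q ->
  (m%:~R == 0 :> 'F_q) = (q%:Z %| m)%Z.
Proof.
move=> q_pr; rewrite {1}[m]intEsign rmorphM rmorph_sign mulf_eq0 signr_eq0 /=.
by rewrite dvdzE /= (dvdn_pcharf (pchar_Fp q_pr)) -pmulrn.
Qed.

Lemma half_sqrt_ex (q : nat) : (2 ^ 20 <= q)%N ->
  exists N, [/\ (2 * N ^ 2 < q)%N, (q <= 8 * N ^ 2)%N & (256 <= N)%N].
Proof.
move=> q20; pose P n := (2 * n ^ 2 < q)%N.
have P256 : P 256%N.
  apply: leq_trans q20; have -> : (256 = 2 ^ 8)%N by [].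
  by rewrite -expnM -expnS ltn_exp2l.
have ub n : P n -> (n <= q)%N.
  by move=> Pn; apply: leq_trans (ltnW Pn); clear; nia.
case: (ex_maxnP (ex_intro P _ P256) ub) => N PN Nmax.
(* Maximality of [N] gives [q <= 2 * (N + 1) ^ 2], well below [8 * N ^ 2]. *)
have N256 := Nmax _ P256; exists N; split=> //.
have : ~~ P N.+1 by apply/negP => /Nmax; rewrite ltnn.
rewrite -leqNgt => /leq_trans; apply; move: N256; clear; nia.
Qed.

Section Rates.
Variable R : realType.

(** Its fourth power still exceeds the contraction factor: two powers absorb the squared logarithm
    and two remain as the square of the error. *)
Definition rate : R := 1 - 1 / (4 * (162 * (2046 * 340))).

Lemma rate_gt0 : 0 < rate. Proof. by rewrite /rate; lra. Qed.

Lemma rate_lt1 : rate < 1. Proof. by rewrite /rate; lra. Qed.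

Lemma gap_factor_le : gap_factor R <= rate ^+ 4.
Proof.
rewrite /gap_factor /rate; set d : R := 1 / (162 * (2046 * 340)).
have -> : 1 / (4 * (162 * (2046 * 340))) = d / 4 by rewrite /d; field.
have d01 : 0 <= d <= 1 by rewrite /d; lra.
clearbody d.
have -> : (1 - d / 4) ^+ 4 = 1 - d + d ^+ 2 * (6 / 16 - d / 16 + d ^+ 2 / 256) by field.
rewrite lerDl; apply: mulr_ge0; first exact: sqr_ge0.
have := sqr_ge0 d; lra.
Qed.

(** The [n + 1] terms of the geometric sum are each at least [rate ^+ n]. *)
Lemma rate_mul_le n : n.+1%:R * rate ^+ n * (1 - rate) <= 1.
Proof.
have r0 := ltW rate_gt0; have r1 := ltW rate_lt1.
suff h : n.+1%:R * rate ^+ n * (1 - rate) <= 1 - rate ^+ n.+1.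
  by apply: le_trans h _; rewrite gerBl exprn_ge0.
elim: n => [|n IH]; first by rewrite expr0 expr1 !mul1r.
rewrite -(natr1 n.+1) [rate ^+ n.+2]exprS.
set x := rate ^+ n.+1 in IH *.
have xE : x = rate * rate ^+ n by rewrite /x exprS.
have x1 : x <= 1 by rewrite exprn_ile1.
have x0 : 0 <= x by rewrite exprn_ge0.
have h1 : (n.+1%:R + 1) * x * (1 - rate) =
  rate * (n.+1%:R * rate ^+ n * (1 - rate)) + x * (1 - rate) by rewrite xE; ring.
have h2 := ler_wpM2l r0 IH.
have h3 : x * (1 - rate) <= 1 - rate by rewrite ler_piMl// subr_ge0.
rewrite h1; lra.
Qed.

Definition amplitude : R := (36 + 72 * 8 * 225 + 4 * 8 ^+ 3) * 128 ^+ 2.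

Lemma amplitude_ge1 : 1 <= amplitude.
Proof.
have h : 1 <= 128 ^+ 2 :> R by rewrite exprn_ege1// ler1n.
have h' : 1 <= 36 + 72 * 8 * 225 + 4 * 8 ^+ 3 :> R by lra.
by rewrite /amplitude; nra.
Qed.

Variable eps : R.
Hypothesis eps_gt0 : 0 < eps.

Definition log2 (q : nat) : nat := trunc_log 2 q.

(** The two steps given up pay for the factor [3 <= 2 ^ 2] in the size of the initial matrices. *)
Definition steps (q : nat) : nat := (Num.truncn (eps * (log2 q)%:R) - 2)%N.

Definition large (q : nat) := (20 <= log2 q)%N && (2 <= eps * (log2 q)%:R).

(** The value 1 for small [q] makes the claim trivial there. Otherwise [3 / eps + 1] compares the
    logarithm with the number of steps, and [1 / (1 - rate)] comes from [rate_mul_le]. *)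
Definition error_rate (q : nat) : R :=
  if large q then amplitude * (3 / eps + 1) / (1 - rate) * rate ^+ steps q else 1.

Lemma stepsE q : large q -> (steps q + 2 = Num.truncn (eps * (log2 q)%:R))%N.
Proof.
move=> /andP[_ h]; rewrite subnK// truncn_ge_nat//.
by apply: le_trans h.
Qed.

Lemma error_rate_gt0 q : 0 < error_rate q.
Proof.
have := amplitude_ge1; have := rate_lt1; have := rate_gt0 => r0 r1 a1.
rewrite /error_rate; case: ifP => _ //; apply: mulr_gt0; last exact: exprn_gt0.
apply: divr_gt0; last by rewrite subr_gt0.
by apply: mulr_gt0; [exact: lt_le_trans a1 | rewrite addr_gt0// divr_gt0].
Qed.

Lemma error_rate_sqr q : large q ->
  gap_factor R ^+ steps q * (amplitude * (log2 q).+1%:R ^+ 2) <= error_rate q ^+ 2.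
Proof.
move=> lq; rewrite /error_rate lq; set n := steps q.
have a1 := amplitude_ge1; have r1 := rate_lt1; have r0 := rate_gt0.
have L1 : (log2 q).+1%:R <= (3 / eps + 1) * n.+1%:R.
  have := truncnS_gt (eps * (log2 q)%:R); rewrite -stepsE// -/n => h.
  have h2 : (log2 q)%:R <= (n + 2).+1%:R / eps by rewrite ler_pdivlMr// mulrC ltW.
  have h3 : (n + 2).+1%:R / eps <= 3 / eps * n.+1%:R.
    rewrite mulrAC ler_pM2r ?invr_gt0// -natrM ler_nat; lia.
  have h4 : 1 <= n.+1%:R :> R by rewrite ler1n.
  by rewrite -natr1 mulrDl mul1r lerD// (le_trans h2 h3).
have g0 : 0 <= gap_factor R by rewrite /gap_factor; lra.
have gn : gap_factor R ^+ n <= (rate ^+ n) ^+ 4.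
  by rewrite -exprM mulnC exprM lerXn2r ?nnegrE ?exprn_ge0 ?(ltW r0)// gap_factor_le.
set c := 3 / eps + 1 in L1 *.
have a0 : 0 <= amplitude by apply: le_trans a1.
have c0 : 0 < c by rewrite addr_gt0// divr_gt0.
have := rate_mul_le n; move: amplitude a0 a1 => amp a0 a1.
set x := rate ^+ n in gn *; set k := n.+1%:R in L1 * => hk.
have x0 : 0 < x by rewrite exprn_gt0.
have k0 : 0 <= k by rewrite /k.
have r2 : 0 < 1 - rate by rewrite subr_gt0.
have xk : k * x <= (1 - rate)^-1 by rewrite -[leRHS]mul1r ler_pdivlMr.
apply: (@le_trans _ _ (x ^+ 4 * (amp ^+ 2 * (c * k) ^+ 2))).
  apply: ler_pM; [by apply: exprn_ge0 | | exact: gn | ].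
    by apply: mulr_ge0 => //; apply: exprn_ge0.
  apply: ler_pM; [exact: a0 | by apply: exprn_ge0 | | ].
    by rewrite expr2 ler_peMl.
  by rewrite lerXn2r ?nnegrE ?mulr_ge0// ltW.
have -> : x ^+ 4 * (amp ^+ 2 * (c * k) ^+ 2) =
  (amp * c * x) ^+ 2 * (k * x) ^+ 2 by ring.
have -> : (amp * c / (1 - rate) * x) ^+ 2 =
  (amp * c * x) ^+ 2 * (1 - rate)^-1 ^+ 2 by ring.
rewrite ler_wpM2l ?sqr_ge0// lerXn2r ?nnegrE ?mulr_ge0 ?(ltW x0)//.
by rewrite invr_ge0 ltW.
Qed.

Lemma error_rate_cvg : (error_rate q @[q --> \oo] --> (0 : R))%classic.
Proof.
have a1 := amplitude_ge1; have r1 := rate_lt1; have r0 := rate_gt0.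
set K := amplitude * (3 / eps + 1) / (1 - rate).
have K0 : 0 < K.
  apply: divr_gt0; last by rewrite subr_gt0.
  by apply: mulr_gt0; [exact: lt_le_trans a1 | rewrite addr_gt0// divr_gt0].
apply/cvgrPdist_lt => e e0.
have /cvgrPdist_lt/(_ (e / K) (divr_gt0 e0 K0)) [n0 _ hn0] :
    ((GRing.exp rate : nat -> R) @ \oo --> (0 : R))%classic.
  by apply: cvg_expr; rewrite gtr0_norm.
(* Beyond [2 ^ M] the integer [q] is [large] and has at least [n0] steps. *)
pose M := (20 + (Num.truncn ((n0 + 2)%:R / eps)).+1)%N.
exists (2 ^ M)%N => // q /= Mq.
have Lq : (M <= log2 q)%N by apply: trunc_log_max.
have ML : (n0 + 2)%:R <= eps * (log2 q)%:R.
  rewrite mulrC -ler_pdivrMr//; apply: le_trans (ltW (truncnS_gt _)) _.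
  by rewrite ler_nat; apply: leq_trans Lq; rewrite leq_addl.
have lq : large q.
  rewrite /large (leq_trans _ Lq) ?leq_addr//=; apply: le_trans ML.
  by rewrite ler_nat leq_addl.
have n0n : (n0 <= steps q)%N.
  rewrite -(leq_add2r 2) stepsE// truncn_ge_nat//.
  by rewrite mulr_ge0// ltW.
have := hn0 _ n0n; rewrite /= !sub0r !normrN gtr0_norm ?exprn_gt0// => h.
rewrite gtr0_norm ?error_rate_gt0// /error_rate lq -/K mulrC.
by rewrite -ltr_pdivlMr.
Qed.

End Rates.

Lemma mx_norm_le (A : 'M[int]_3) (b : int) : 0 <= b -> bounded_by b A -> mx_norm A <= b.
Proof.
move=> b0 hb; rewrite mx_normE.
have -> : b = (NngNum b0)%:num by [].
rewrite num_le; apply/bigmax_leP; split=> [|[i j] _]; rewrite -num_le//=.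
Qed.

Lemma size_le (R : realType) (eps : R) (q N : nat) : 0 < eps -> (0 < q)%N ->
  large eps q -> (2 * N ^ 2 < q)%N ->
  (2 ^+ steps eps q * (3 * N%:Z))%:~R <= q%:R `^ (2^-1 + eps).
Proof.
move=> e0 q0 lq Nq; have qR : 0 < q%:R :> R by rewrite ltr0n.
rewrite powRD; last by rewrite (gt_eqF qR) implybT.
rewrite !rmorphM rmorphXn /= mulrA [leRHS]mulrC.
have hN : N%:R <= q%:R `^ 2^-1 :> R.
  rewrite powR12_sqrt// -[leLHS]ger0_norm// -sqrtr_sqr ler_wsqrtr// -natrX ler_nat.
  by apply: leq_trans (ltnW Nq); rewrite leq_pmull.
have hs : 2 ^+ steps eps q * 3 <= q%:R `^ eps :> R.
  apply: (@le_trans _ _ (2 ^+ (steps eps q + 2))).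
    rewrite exprD ler_wpM2l ?exprn_ge0//; lra.
  rewrite stepsE// -powR_mulrn//.
  have L0 : 0 <= eps * (log2 q)%:R by rewrite mulr_ge0// ltW.
  apply: (@le_trans _ _ (2 `^ (eps * (log2 q)%:R))).
    by rewrite ler_powR// ?ler1n// truncn_le.
  rewrite mulrC powRrM powR_mulrn//; apply: ge0_ler_powR; rewrite ?nnegrE ?exprn_ge0//.
    exact: ltW.
  by rewrite -natrX ler_nat trunc_logP.
by rewrite ler_pM ?mulr_ge0 ?exprn_ge0// ?ler0z.
Qed.

Lemma Phi_mx_act (q : nat) (g : SL3Z) (x : flag q) :
  Phi q g x = mx_act (reduce 'F_q g) x.
Proof.
rewrite permE; apply: val_inj; rewrite /= val_mx_act//.
exact: reduce_unit.
Qed.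

Local Open Scope classical_set_scope.

Theorem theorem5p1 (R : realType) (eps : R) :
  0 < eps ->
  exists f : nat -> R,
    f q @[q --> within [set q : nat | prime q] \oo] --> (0 : R) /\
    forall q : nat, prime q ->
      exists Y : {set flag q},
        (1 - f q) * #|flag q|%:R <= #|Y|%:R /\
        forall x : flag q, x \in Y ->
          exists Z : {set flag q},
            (1 - f q) * #|flag q|%:R <= #|Z|%:R /\
            forall y : flag q, y \in Z ->
              exists g : SL3Z,
                (mx_norm (val g))%:~R <= q%:R `^ (2^-1 + eps) /\
                Phi q g x = y.
Proof.
move=> e0; exists (error_rate eps); split.
  apply: cvg_trans (error_rate_cvg e0); apply: cvg_app; exact: cvg_within.
move=> q q_pr; have [lq|nlq] := boolP (large eps q); last first.
  exists finset.set0; rewrite /error_rate (negPf nlq) subrr mul0r; split=> // x.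
  by rewrite inE.
have q0 := prime_gt0 q_pr.
have q20 : (2 ^ 20 <= q)%N.
  apply: leq_trans (_ : 2 ^ log2 q <= q)%N; last by rewrite trunc_logP.
  by rewrite leq_exp2l//; case/andP: lq.
have [N [N2q qN N256]] := half_sqrt_ex q20.
have intF m := @intr_Fp_eq0 q m q_pr.
have cardF : #|'F_q| = q by apply: card_Fp.
have FT : relative_T 'F_q (340 : R) := relative_T_Fp q_pr.
pose ok (u : 'I_N * 'I_N * 'I_N * ('I_N * 'I_N * 'I_N)) (g : SL3Z) :=
  admissible u ->
  [/\ forall k, val g 0 k = ent (entry u.1 k),
      forall k, val g 1 k = ent (entry u.2 k)
    & bounded_by (3 * N%:Z) (val g)].
have [lift liftP] : exists lift, forall u, ok u (lift u).
  suff /boolp.choice[lift liftP] : forall u, exists g, ok u g by exists lift.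
  move=> u.
  have [/andP[_ au]|nau] := boolP (admissible u).
    by have [g gP] := complete_rows au; exists g => _.
  have d1 : \det (1%:M : 'M[int]_3) == 1 by rewrite det1.
  by exists (exist (fun A : 'M[int]_3 => is_true (\det A == 1)) _ d1) => au; rewrite au in nau.
set s := error_rate eps q; have s0 : 0 < s := error_rate_gt0 e0 q.
pose n := steps eps q.
pose mis (x : flag q) : {set flag q} := missed R lift n x.
have misP x y : y \notin mis x -> exists g : SL3Z,
    (mx_norm (val g))%:~R <= q%:R `^ (2^-1 + eps) /\ Phi q g x = y.
  move=> /(missedP liftP)[g gb gx]; exists g; rewrite Phi_mx_act; split=> //.
  apply: le_trans (size_le e0 q0 lq N2q); rewrite ler_int; apply: mx_norm_le => //.
set B : R := #|flag q|%:R.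
(* One factor [s] is spent on the choice of [x] and the other on that of [y]. *)
have total : \sum_(x : flag q) #|mis x|%:R <= B ^+ 2 * s ^+ 2.
  apply: le_trans (sum_missed_le FT intF cardF N2q qN N256 liftP n) _.
  rewrite ler_wpM2l ?sqr_ge0//; apply: le_trans (error_rate_sqr e0 lq).
  have g0 : 0 <= gap_factor R by rewrite /gap_factor; lra.
  have H0 : 0 <= harmonic_sum R N by apply: sumr_ge0.
  rewrite ler_wpM2l ?exprn_ge0// ler_wpM2l; first by [].
    by have := amplitude_ge1 R; rewrite /amplitude; lra.
  rewrite lerXn2r ?nnegrE//; apply: le_trans (harmonic_sum_le R N) _.
  rewrite ler_nat ltnS /log2; apply: trunc_log_max => //.
  apply: leq_trans (trunc_logP _ _) _ => //; first by apply: leq_trans N256.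
  by apply: leq_trans (ltnW N2q); nia.
have large_compl (A : {set flag q}) : #|~: A|%:R <= s * B -> (1 - s) * B <= #|A|%:R.
  move=> h; have := cardsC A => /(congr1 (fun k => k%:R : R)); rewrite natrD -/B; lra.
exists [set x | #|mis x|%:R <= s * B]%SET; split; last first.
  move=> x; rewrite inE => hx; exists (~: mis x)%SET; split.
    by apply: large_compl; rewrite finset.setCK.
  by move=> y; rewrite inE => /misP.
apply: large_compl; set A := (~: _)%SET.
have B0 : 0 <= B by rewrite /B.
have [Bz|Bn] := eqVneq B 0.
  by rewrite Bz mulr0 -Bz ler_nat max_card.
have sB : 0 < s * B by rewrite mulr_gt0// lt0r Bn.
(* Markov's inequality: each excluded [x] misses more than [s * B] flags. *)
rewrite -(ler_pM2r sB); apply: (@le_trans _ _ (\sum_(x : flag q) #|mis x|%:R)).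
  rewrite mulr_natl -sumr_const big_mkcond /=; apply: ler_sum => x _.
  case: ifPn => //; rewrite !inE -ltNge; exact: ltW.
by apply: le_trans total _; rewrite le_eqVlt; apply/orP; left; apply/eqP; ring.
Qed.
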